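(* There exists a square root $G\in\mathcal{S}$ of Thompson's group $F$ which contains a subgroup isomorphic to the free group of rank two.
   Context: Let $I=[0,1]$ and let $\mathrm{Homeo}^+(I)$ be the group of orientation-preserving homeomorphisms of $I$. For a homeomorphism $f$, $\operatorname{supp} f=\{x : f(x)\neq x\}$. Two nonempty open intervals $J_1,J_2$ form a two-chain if $J_1\cap J_2$ is a nonempty proper subinterval of $J_1$ and of $J_2$. Thompson's group is $F\cong\langle A,B\mid [A,(AB)^{-1}B(AB)],\ [A,(AB)^{-2}B(AB)^2]\rangle$. A square root of $F$ is a two-generated subgroup $\langle f,g\rangle<\mathrm{Homeo}^+(I)$ such that $\langle f^2,g^2\rangle\cong F$ and such that $\operatorname{supp} f$ and $\operatorname{supp} g$ are open intervals forming a two-chain. $\mathcal{S}$ denotes the set of isomorphism classes of square roots of $F$; $G\in\mathcal S$ means that $G$ is a square root of $F$. *)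

(* Defs.v *)
From HB Require Import structures.
From mathcomp Require Import all_boot all_order all_algebra.
From mathcomp Require Import all_classical all_reals all_analysis.
Set Implicit Arguments.
Unset Strict Implicit.
Unset Printing Implicit Defensive.
Import Order.TTheory GRing.Theory Num.Theory.
Import numFieldNormedType.Exports.
Local Open Scope quotient_scope.
Local Open Scope classical_set_scope.
Local Open Scope ring_scope.

(* Groups are the (possibly infinite) [groupType]s of [mathcomp.boot.monoid]. *)

Definition is_subgroup (G : groupType) (H : set G) : Prop :=
  group_closed (mem H).

Definition generated (G : groupType) (A : set G) : set G :=
  smallest (@is_subgroup G) A.

(* The subgroup carried by [H] is isomorphic to the abstract group [K]. *)
Definition isomorphic (G : groupType) (H : set G) (K : groupType) : Prop :=
  exists phi : {multiplicative K -> G}, set_bij [set: K] H phi.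

(* Words in the letters x (encoded as [(x, false)]) and x^-1 (encoded as
   [(x, true)]). *)
Definition word (X : choiceType) := seq (X * bool).

Definition winv (X : choiceType) (w : word X) : word X :=
  rev [seq (l.1, ~~ l.2) | l <- w].

Definition wconj (X : choiceType) (u v : word X) : word X :=
  winv v ++ u ++ v.

Definition wcomm (X : choiceType) (u v : word X) : word X :=
  winv u ++ winv v ++ u ++ v.

Inductive pres_eq (X : choiceType) (rels : set (word X)) :
    word X -> word X -> Prop :=
| pres_cancel u v x b :
    pres_eq rels (u ++ [:: (x, b); (x, ~~ b)] ++ v) (u ++ v)
| pres_rel u v r : rels r -> pres_eq rels (u ++ r ++ v) (u ++ v)
| pres_refl u : pres_eq rels u u
| pres_sym u v : pres_eq rels u v -> pres_eq rels v u
| pres_trans u v w : pres_eq rels u v -> pres_eq rels v w -> pres_eq rels u w.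

Section Presented.
Variables (X : choiceType) (rels : set (word X)).
Local Notation req := (pres_eq rels).

Definition pres_eqb (u v : word X) : bool := `[< req u v >].

Lemma pres_eqb_refl : reflexive pres_eqb.
Proof. by move=> u; apply/asboolP/pres_refl. Qed.

Lemma pres_eqb_sym : symmetric pres_eqb.
Proof. by move=> u v; apply/asboolP/asboolP => /pres_sym. Qed.

Lemma pres_eqb_trans : transitive pres_eqb.
Proof.
by move=> v u w /asboolP uv /asboolP vw; apply/asboolP/(pres_trans uv vw).
Qed.

Canonical pres_equiv :=
  EquivRel pres_eqb pres_eqb_refl pres_eqb_sym pres_eqb_trans.

Definition presented : Type := {eq_quot pres_equiv}%qT.

HB.instance Definition _ := Choice.on presented.
HB.instance Definition _ := Quotient.on presented.

Lemma pres_piP (u v : word X) :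
  reflect (\pi_presented u = \pi_presented v) `[< req u v >].
Proof. exact: (@eqmodP _ pres_equiv). Qed.

Lemma pres_repr (u : word X) : req (repr (\pi_presented u)) u.
Proof. by apply/asboolP/pres_piP; rewrite reprK. Qed.

Lemma pres_catl (w u v : word X) : req u v -> req (w ++ u) (w ++ v).
Proof.
elim=> {u v} [u v x b|u v r rr|u|u v _|u v t _ uv _] /=.
- by rewrite !(catA w u); apply: pres_cancel.
- by rewrite !(catA w u); apply: pres_rel.
- exact: pres_refl.
- exact: pres_sym.
- exact: pres_trans.
Qed.

Lemma pres_catr (w u v : word X) : req u v -> req (u ++ w) (v ++ w).
Proof.
elim=> {u v} [u v x b|u v r rr|u|u v _|u v t _ uv _] /=.
- by rewrite -!catA; apply: pres_cancel.
- by rewrite -!catA; apply: pres_rel.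
- exact: pres_refl.
- exact: pres_sym.
- exact: pres_trans.
Qed.

Lemma pres_cat (u u' v v' : word X) :
  req u u' -> req v v' -> req (u ++ v) (u' ++ v').
Proof. by move=> /(pres_catr v) /pres_trans + /(pres_catl u'); apply. Qed.

Lemma winv_cat (u v : word X) : winv (u ++ v) = winv v ++ winv u.
Proof. by rewrite /winv map_cat rev_cat. Qed.

Lemma pres_winvl (u : word X) : req (winv u ++ u) [::].
Proof.
elim: u => [|[x b] u IHu]; first exact: pres_refl.
rewrite -cat1s winv_cat -catA; apply: pres_trans IHu.
by have := pres_cancel rels (winv u) u x (~~ b); rewrite negbK.
Qed.

Lemma winvK : involutive (@winv X).
Proof.
move=> u; rewrite /winv map_rev revK -map_comp map_id_in //.
by move=> [x b] _ /=; rewrite negbK.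
Qed.

Lemma pres_winvr (u : word X) : req (u ++ winv u) [::].
Proof. by rewrite -{1}(winvK u); apply: pres_winvl. Qed.

Definition pres_mul (a b : presented) : presented :=
  \pi_presented (repr a ++ repr b).
Definition pres_one : presented := \pi_presented [::].
Definition pres_inv (a : presented) : presented := \pi_presented (winv (repr a)).

Lemma pres_mulA : associative pres_mul.
Proof.
move=> a b c; apply/pres_piP/asboolP.
apply: (@pres_trans _ _ _ (repr a ++ repr b ++ repr c)).
  exact/pres_catl/pres_repr.
by rewrite catA; apply/pres_catr/pres_sym/pres_repr.
Qed.

Lemma pres_mul1 : left_id pres_one pres_mul.
Proof.
move=> a; rewrite -[RHS]reprK; apply/pres_piP/asboolP.
exact: (pres_catr (repr a) (pres_repr [::])).
Qed.

Lemma pres_mulr1 : right_id pres_one pres_mul.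
Proof.
move=> a; rewrite -[RHS]reprK; apply/pres_piP/asboolP.
by have := pres_catl (repr a) (pres_repr [::]); rewrite cats0.
Qed.

Lemma pres_mulV : left_inverse pres_one pres_inv pres_mul.
Proof.
move=> a; apply/pres_piP/asboolP/pres_trans/(pres_winvl (repr a)).
exact/pres_catr/pres_repr.
Qed.

Lemma pres_mulVr : right_inverse pres_one pres_inv pres_mul.
Proof.
move=> a; apply/pres_piP/asboolP/pres_trans/(pres_winvr (repr a)).
exact/pres_catl/pres_repr.
Qed.

HB.instance Definition _ := isGroup.Build presented
  pres_mulA pres_mul1 pres_mulr1 pres_mulV pres_mulVr.

End Presented.

Definition free_group (n : nat) : groupType := @presented 'I_n set0.

Definition thompsonF : groupType :=
  let A : word 'I_2 := [:: (ord0, false)] in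
  let B : word 'I_2 := [:: (ord_max, false)] in
  let AB := A ++ B in
  @presented 'I_2
    [set wcomm A (wconj B AB); wcomm A (wconj B (AB ++ AB))].

(* The unit interval, with the topology induced by that of [R]. *)
Definition unitI (R : realType) : Type := set_type (`[0, 1] : set R).
HB.instance Definition _ (R : realType) := Topological.on (unitI R).

(* Orientation-preserving homeomorphisms of the unit interval; the inverse is
   determined by the map itself, see [homeoI_eq]. *)
Record homeoI (R : realType) := HomeoI {
  homeo_fun :> unitI R -> unitI R;
  homeo_inv : unitI R -> unitI R;
  homeo_funK : cancel homeo_fun homeo_inv;
  homeo_invK : cancel homeo_inv homeo_fun;
  homeo_cts : continuous homeo_fun;
  homeo_inv_cts : continuous homeo_inv;
  homeo_incr : forall x y : unitI R,
    set_val x < set_val y -> set_val (homeo_fun x) < set_val (homeo_fun y)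
}.

Section HomeoGroup.
Variable R : realType.
Implicit Types f g h : homeoI R.

Lemma homeoI_eq f g : homeo_fun f =1 homeo_fun g -> f = g.
Proof.
move=> fg; have : homeo_inv f =1 homeo_inv g.
  by move=> x; apply: (can_inj (homeo_funK g)); rewrite -fg !homeo_invK.
case: f g fg => [f f' a b c d e] [g g' a' b' c' d' e'] /= /funext fg /funext fg'.
by subst; congr HomeoI; apply: Prop_irrelevance.
Qed.

Lemma homeo_inv_incr f (x y : unitI R) :
  set_val x < set_val y -> set_val (homeo_inv f x) < set_val (homeo_inv f y).
Proof.
move=> xy; rewrite ltNge le_eqVlt; apply/negP => /orP[/eqP /val_inj yx|].
  by move: xy; rewrite (can_inj (homeo_invK f) yx) ltxx.
by move=> /(homeo_incr f); rewrite !homeo_invK ltNge (ltW xy).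
Qed.

Definition homeo_one : homeoI R :=
  @HomeoI R id id (fun=> erefl) (fun=> erefl)
    (fun _ => cvg_id) (fun _ => cvg_id) (fun _ _ xy => xy).

Program Definition homeo_mul f g : homeoI R :=
  @HomeoI R (f \o g) (homeo_inv g \o homeo_inv f) _ _ _ _ _.
Next Obligation. by move=> f g; apply: can_comp; apply: homeo_funK. Qed.
Next Obligation. by move=> f g; apply: can_comp; apply: homeo_invK. Qed.
Next Obligation.
by move=> f g x; apply: continuous_comp; apply: homeo_cts.
Qed.
Next Obligation.
by move=> f g x; apply: continuous_comp; apply: homeo_inv_cts.
Qed.
Next Obligation. by move=> f g x y xy; do 2!apply: homeo_incr. Qed.

Definition homeo_Vg f : homeoI R :=
  HomeoI (homeo_invK f) (homeo_funK f) (@homeo_inv_cts _ f) (@homeo_cts _ f)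
    (@homeo_inv_incr f).

Lemma homeo_mulA : associative homeo_mul.
Proof. by move=> f g h; apply: homeoI_eq. Qed.
Lemma homeo_mul1 : left_id homeo_one homeo_mul.
Proof. by move=> f; apply: homeoI_eq. Qed.
Lemma homeo_mulr1 : right_id homeo_one homeo_mul.
Proof. by move=> f; apply: homeoI_eq. Qed.
Lemma homeo_mulV : left_inverse homeo_one homeo_Vg homeo_mul.
Proof. by move=> f; apply: homeoI_eq => x /=; rewrite homeo_funK. Qed.
Lemma homeo_mulVr : right_inverse homeo_one homeo_Vg homeo_mul.
Proof. by move=> f; apply: homeoI_eq => x /=; rewrite homeo_invK. Qed.

End HomeoGroup.

HB.instance Definition _ (R : realType) := gen_eqMixin (homeoI R).
HB.instance Definition _ (R : realType) := gen_choiceMixin (homeoI R).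
HB.instance Definition _ (R : realType) := isGroup.Build (homeoI R)
  (@homeo_mulA R) (@homeo_mul1 R) (@homeo_mulr1 R)
  (@homeo_mulV R) (@homeo_mulVr R).

(* The support, viewed as a subset of [R]; it never contains the endpoints 0
   and 1, so being open in [R] or in the unit interval amounts to the same. *)
Definition supp (R : realType) (f : homeoI R) : set R :=
  [set set_val x | x in [set x : unitI R | f x != x]].

Definition open_interval (R : realType) (J : set R) : Prop :=
  [/\ J !=set0, open J & is_interval J].

Definition two_chain (R : realType) (J1 J2 : set R) : Prop :=
  [/\ open_interval J1, open_interval J2,
      is_interval (J1 `&` J2) /\ J1 `&` J2 !=set0,
      J1 `&` J2 `<` J1 & J1 `&` J2 `<` J2].

Definition square_root_of_F (R : realType) (G : set (homeoI R)) : Prop :=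
  exists f g : homeoI R,
    [/\ G = generated [set f; g],
        isomorphic (generated [set (f ^+ 2)%g; (g ^+ 2)%g]) thompsonF
      & two_chain (supp f) (supp g)].

(* Main.v *)
Require Import Defs.
From HB Require Import structures.
From mathcomp Require Import all_boot all_order all_algebra.
From mathcomp Require Import all_classical all_reals all_analysis.
From mathcomp Require Import ring lra zify.
Set Implicit Arguments.
Unset Strict Implicit.
Unset Printing Implicit Defensive.
Import Order.TTheory GRing.Theory Num.Theory.
Import numFieldNormedType.Exports.
Local Open Scope quotient_scope.
Local Open Scope classical_set_scope.

(** Identify the open interval with the line. Thompson's group acts there,
  generated by [A], supported on (0, oo), and [B], supported on (-oo, 1), with
  A B = (x |-> x + 1). A root of [A] may be prescribed freely on half of a
  fundamental domain. The commutator E of A and B has the single bump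
  J = (-1, 1), and conjugates of E by elements u and v of F have the bumps (1, 3/2)
  and (3/2, 2), which fill the fundamental domain [1, 2] of A. A root f of A that
  maps the first bump to the second by v eta u^-1 then conjugates u E u^-1 to
  v (eta E eta^-1) v^-1, where eta E eta^-1 can be made any homeomorphism M without
  fixed points in J. Take M = E^4 h with h commuting with E^4 and hyperbolic on
  the circle J / E^4: then h lies in the group generated by f and B, and h and
  E h E^-1 play ping-pong on that circle. *)

(** * Words and presentations *)

Local Open Scope group_scope.

Section WordEvaluation.
Variables (X : choiceType) (G : groupType) (e : X -> G).

Definition letter_val (l : X * bool) : G := if l.2 then (e l.1)^-1 else e l.1.

Definition word_val (w : word X) : G := foldr (fun l g => letter_val l * g) 1 w.

Lemma word_val_cat u v : word_val (u ++ v) = word_val u * word_val v.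
Proof. by elim: u => [|l u IHu] /=; rewrite ?mul1g // IHu mulgA. Qed.

Lemma letter_valV x b : letter_val (x, ~~ b) = (letter_val (x, b))^-1.
Proof. by case: b; rewrite /letter_val ?invgK. Qed.

Lemma word_valV u : word_val (winv u) = (word_val u)^-1.
Proof.
elim: u => [|[x b] u IHu] /=; first by rewrite invg1.
by rewrite -cat1s winv_cat word_val_cat IHu /= mulg1 letter_valV invgM.
Qed.

Lemma word_val_pres (rels : set (word X)) (u v : word X) :
  (forall r, rels r -> word_val r = 1) -> pres_eq rels u v ->
  word_val u = word_val v.
Proof.
move=> e1; elim=> {u v} [u v x b|u v r /e1 r1|//|u v _ ->//|u v w _ -> //].
  by rewrite !word_val_cat /= letter_valV mulg1 mulgV mul1g.
by rewrite !word_val_cat r1 mul1g.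
Qed.

End WordEvaluation.

Section PresentedGroup.
Variables (X : choiceType) (rels : set (word X)).
Local Notation PG := (presented rels).

Definition pgen (x : X) : PG := \pi_PG [:: (x, false)].

Lemma pi_mul (u v : word X) : \pi_PG (u ++ v) = \pi_PG u * \pi_PG v.
Proof.
by apply/pres_piP/asboolP/pres_sym/pres_cat; apply: pres_repr.
Qed.

Lemma pi_word (w : word X) : \pi_PG w = word_val pgen w.
Proof.
elim: w => [//|[x b] w IHw].
rewrite -cat1s pi_mul IHw; congr (_ * _).
case: b => //; rewrite /letter_val /=.
apply: esym; rewrite -[LHS]mulg1; apply: canLR (mulKg _) _.
rewrite -pi_mul; apply/pres_piP/asboolP/pres_sym.
by have := pres_cancel rels [::] [::] x false.
Qed.

Lemma presented_ind (P : PG -> Prop) :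
  P 1 -> (forall z l, P z -> P (z * letter_val pgen l)) -> forall z, P z.
Proof.
move=> P1 PM z; rewrite -(reprK z) pi_word.
elim/last_ind: (repr z) => [//|w l IHw].
by rewrite -cats1 word_val_cat /= mulg1; apply: PM.
Qed.

Lemma pres_rel1 r : rels r -> word_val pgen r = 1.
Proof.
move=> rr; rewrite -pi_word; apply/pres_piP/asboolP.
by have := pres_rel [::] [::] rr; rewrite cats0.
Qed.

Variables (G : groupType) (e : X -> G).
Hypothesis e_rels : forall r, rels r -> word_val e r = 1.

Definition pres_lift_fun (z : PG) : G := word_val e (repr z).

Lemma pres_lift_pi (w : word X) : pres_lift_fun (\pi_PG w) = word_val e w.
Proof. exact: word_val_pres e_rels (pres_repr _ _). Qed.

Lemma pres_lift_mul (y z : PG) :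
  pres_lift_fun (y * z) = pres_lift_fun y * pres_lift_fun z.
Proof.
by rewrite -{1}(reprK y) -{1}(reprK z) -pi_mul pres_lift_pi word_val_cat.
Qed.

Lemma pres_lift : exists phi : UMagmaMorphism.type PG G,
  forall w, phi (\pi_PG w) = word_val e w.
Proof.
pose F := isUMagmaMorphism.Build PG G pres_lift_fun
  (pres_lift_pi [::], pres_lift_mul).
pose phi : UMagmaMorphism.type PG G := HB.pack pres_lift_fun F.
by exists phi; apply: pres_lift_pi.
Qed.

End PresentedGroup.

Section Subgroups.
Variable G : groupType.
Implicit Types H : set G.

Lemma subgroup1 H : is_subgroup H -> H 1.
Proof. by case=> /set_mem. Qed.

Lemma subgroupF H x y : is_subgroup H -> H x -> H y -> H (x / y).
Proof.
by case=> _ HF Hx Hy; apply/set_mem/HF; apply: mem_set.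
Qed.

Lemma subgroupV H x : is_subgroup H -> H x -> H x^-1.
Proof. by move=> sH Hx; rewrite -div1g; apply: subgroupF => //; apply: subgroup1. Qed.

Lemma subgroupM H x y : is_subgroup H -> H x -> H y -> H (x * y).
Proof.
by move=> sH Hx Hy; rewrite -[y]invgK; apply: subgroupF => //; apply: subgroupV.
Qed.

Lemma subgroup_word_val (X : choiceType) (e : X -> G) H (w : word X) :
  is_subgroup H -> (forall x, H (e x)) -> H (word_val e w).
Proof.
move=> sH He; elim: w => [|[x b] w IHw]; first exact: subgroup1.
apply: subgroupM => //; rewrite /letter_val.
by case: b => //=; apply: subgroupV.
Qed.

Lemma generated_subgroup (A : set G) : is_subgroup (generated A).
Proof.
split=> [|x y /set_mem Ax /set_mem Ay]; apply/mem_set => H [sH AH].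
  exact: subgroup1.
by apply: subgroupF => //; [apply: Ax|apply: Ay].
Qed.

Lemma sub_generated (A : set G) : A `<=` generated A.
Proof. by move=> x Ax H [_]; apply. Qed.

Lemma range_subgroup (K : groupType) (phi : UMagmaMorphism.type K G) :
  is_subgroup (range phi).
Proof.
split=> [|_ _ /set_mem[x _ <-] /set_mem[y _ <-]]; apply/mem_set.
  by exists 1; rewrite ?gmulf1.
by exists (x / y); rewrite // gmulfF.
Qed.

End Subgroups.

Lemma generated_sub (G : groupType) (A H : set G) :
  is_subgroup H -> A `<=` H -> generated A `<=` H.
Proof. by move=> sH AH x; apply. Qed.

(** * Free reduction and ping-pong *)

Section FreeReduction.
Variables (X : choiceType).

Definition cancelling (l m : X * bool) : bool := m == (l.1, ~~ l.2).

Definition reduced (w : word X) : bool :=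
  sorted (fun l m => ~~ cancelling l m) w.

Lemma reduced_rep (rels : set (word X)) (w : word X) :
  exists2 w', reduced w' & pres_eq rels w w'.
Proof.
elim: w => [|l w [w' rw' ww']]; first by exists [::] => //; apply: pres_refl.
have lw := pres_catl [:: l] ww'.
case: w' rw' lw {ww'} => [|m w'] rw' lw; first by exists [:: l].
have [lm|lm] := boolP (cancelling l m); last first.
  by exists [:: l, m & w'] => //=; rewrite /reduced /= lm.
exists w'; first exact: path_sorted rw'.
apply: pres_trans lw _; case: l lm => x b /eqP -> /=.
exact: pres_cancel rels [::] w' x b.
Qed.

(** [U l] attracts under the letter [l], and the set of the inverse letter is the part of [D] that
    [l] need not send there. The last letter of a nonempty reduced word moves [x0] into its own set,
    and each further letter carries the image on into its own; since [x0] is in none of these sets,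
    the word does not act trivially. *)
Lemma ping_pong (G : groupType) (e : X -> G) (T : Type) (act : G -> T -> T)
    (D : set T) (U : X * bool -> set T) (x0 : T) :
  (forall x, act 1 x = x) -> (forall g h x, act (g * h) x = act g (act h x)) ->
  D x0 -> (forall l, ~ U l x0) ->
  (forall l, U l `<=` D) -> (forall l m x, U l x -> U m x -> l = m) ->
  (forall x b y, D y -> ~ U (x, ~~ b) y ->
    U (x, b) (act (letter_val e (x, b)) y)) ->
  forall w : word X, word_val e w = 1 -> pres_eq set0 w [::].
Proof.
move=> act1 actM Dx0 Ux0 UD Udisj pp w w1.
have [w' rw' ww'] := reduced_rep set0 w.
apply: (pres_trans ww'); have {}w1 : word_val e w' = 1.
  by rewrite -w1; apply/esym; apply: word_val_pres ww' => r [].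
case: w' rw' w1 {ww'} => [_ _|l w' rw' w1]; first exact: pres_refl.
suff Ul : forall v m, reduced (m :: v) -> U m (act (word_val e (m :: v)) x0).
  by case: (Ux0 l); have := Ul _ _ rw'; rewrite w1 act1.
elim=> [|k v IHv] [x b] /=; rewrite /reduced actM => r.
  by rewrite act1; apply: pp.
move: r => /= /andP[mk /IHv]; set y := act _ x0 => Uk.
(* If the image were in the set of the inverse of [(x, b)], disjointness would make [k] that
   inverse, against reducedness. *)
by apply: pp => [|Uy]; [apply: UD Uk|
  rewrite /cancelling (Udisj _ _ _ Uk Uy) eqxx in mk].
Qed.

End FreeReduction.

Lemma injective_kernel (K G : groupType) (phi : UMagmaMorphism.type K G) :
  (forall x, phi x = 1 -> x = 1) -> isomorphic (range phi) K.
Proof.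
move=> ker1; exists phi; split=> [x _|x y _ _|//]; first by exists x.
exact: (gmulf_inj ker1).
Qed.

(** The minimality clause is what later places the free group inside the square root. *)
Lemma free_isomorphic (G : groupType) (n : nat) (e : 'I_n -> G) :
  (forall w : word 'I_n, word_val e w = 1 -> pres_eq set0 w [::]) ->
  exists H : set G, [/\ is_subgroup H,
    forall K, is_subgroup K -> (forall i, K (e i)) -> H `<=` K &
    isomorphic H (free_group n)].
Proof.
move=> ker1.
have [|phi phiE] := @pres_lift _ (set0 : set (word 'I_n)) _ e; first by move=> r [].
exists (range phi); split; first exact: range_subgroup.
- move=> K sK Ke _ [z _ <-]; rewrite -(reprK z) phiE.
  exact: subgroup_word_val.
- apply: injective_kernel => z; rewrite -(reprK z) phiE => /ker1 z1.
  exact/pres_piP/asboolP.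
Qed.

(** * Normal forms in Thompson's group *)

Section ThompsonGenerators.
Variables (G : groupType) (a b : G).

(* Locked because rewriting with [mulgA] and [invgM] would unfold [thX n.+1]. *)
Definition thX (n : nat) : G :=
  locked (if n is k.+1 then b ^ ((a * b) ^+ k) else a * b).

Lemma thX0 : thX 0 = a * b. Proof. by rewrite /thX -lock. Qed.

Lemma thXE n : thX n.+1 = b ^ ((a * b) ^+ n). Proof. by rewrite /thX -lock. Qed.

Lemma thX1 : thX 1 = b. Proof. by rewrite thXE expg0 conjg1. Qed.

Definition thP (s : seq nat) : G := foldr (fun n g => thX n * g) 1 s.

Lemma thP_cat s t : thP (s ++ t) = thP s * thP t.
Proof. by elim: s => [|n s IHs] /=; rewrite ?mul1g // IHs mulgA. Qed.

Lemma thXD n k : thX n.+1 ^ ((a * b) ^+ k) = thX (n + k).+1.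
Proof. by rewrite !thXE -conjgM expgnDr. Qed.

Lemma thXS n : thX n.+1 ^ (a * b) = thX n.+2.
Proof. by have := thXD n 1; rewrite expg1 addn1. Qed.

Hypotheses (ab2 : commute a (thX 2)) (ab3 : commute a (thX 3)).

(** Since [b = a^-1 * (a * b)] and [a] centralizes [thX n.+2], conjugation by [b] has the same
    effect as conjugation by [a * b], which shifts the index. *)
Lemma thX_conj1 n : commute a (thX n.+2) -> thX n.+2 ^ thX 1 = thX n.+3.
Proof.
move=> an; have -> : thX 1 = a^-1 * (a * b) by rewrite mulKg thX1.
rewrite conjgM; have -> : thX n.+2 ^ a^-1 = thX n.+2.
  exact/conjg_fixP/commgP/commuteV/commute_sym.
exact: thXS.
Qed.

(* [thX n.+4] is the conjugate of [thX n.+3] by [thX 2], so the two given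
   relations propagate by induction. *)
Lemma commute_thX n : commute a (thX n.+2).
Proof.
suff: commute a (thX n.+2) /\ commute a (thX n.+3) by case.
elim: n => [//|n [an2 an3]]; split=> //.
have -> : thX n.+4 = thX n.+3 ^ thX 2.
  by rewrite -(thXS n.+2) -[in LHS](thX_conj1 an2) conjJg !thXS.
rewrite conjgE; apply: commuteM; first exact: commuteV.
exact: commuteM.
Qed.

Lemma thX_conj k n : (k < n)%N -> thX n ^ thX k = thX n.+1.
Proof.
case: k n => [|k] [//|n] kn.
  by rewrite thX0 thXS.
have -> : thX n.+1 = thX (n - k.+1).+2 ^ ((a * b) ^+ k).
  by rewrite thXD; congr (thX _.+1); lia.
have -> : thX k.+1 = thX 1 ^ ((a * b) ^+ k) by rewrite thXD add0n.
rewrite -conjJg thX_conj1; last exact: commute_thX.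
by rewrite thXD; congr (thX _.+1); lia.
Qed.

(** These are the relations of the infinite presentation of F on x_0 = AB, x_1 = B, x_2, and so
    on. *)
Lemma thXC k n : (k < n)%N -> thX n * thX k = thX k * thX n.+1.
Proof. by move=> kn; rewrite conjgC thX_conj. Qed.

Lemma thXVC k n : (k < n)%N -> (thX n)^-1 * thX k = thX k * (thX n.+1)^-1.
Proof.
by move=> kn; apply: (canRL (mulgK _)); rewrite -mulgA -(thXC kn) mulKg.
Qed.

Lemma thXCV k n : (k < n)%N -> (thX k)^-1 * thX n = thX n.+1 * (thX k)^-1.
Proof.
by move=> kn; apply: (canRL (mulgK _)); rewrite -mulgA (thXC kn) mulKg.
Qed.

(** Insertion sort: a letter that moves right past a smaller one has its index raised by one, hence
    stays larger. *)
Lemma thX_sorted s : exists2 s', sorted leq s' & thP s' = thP s.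
Proof.
(* The clause on lower bounds keeps the head of the list smallest after an insertion into its
   tail. *)
have insert n s1 : sorted leq s1 ->
    exists2 s2, sorted leq s2 &
      thP s2 = thX n * thP s1 /\
      forall k, (k <= n)%N -> all (leq k) s1 -> all (leq k) s2.
  elim: s1 n => [|m s1 IHs] n /= sm.
    by exists [:: n] => //; split=> // k kn _ /=; rewrite kn.
  have [nm|mn] := leqP n m.
    exists [:: n, m & s1]; first by rewrite /= nm.
    by split=> // k kn /= ->; rewrite kn.
  have [s2 ss2 [s2E s2k]] := IHs n.+1 (path_sorted sm).
  have ms1 : all (leq m) s1 by apply: (order_path_min leq_trans).
  exists (m :: s2).
    by rewrite /= (path_sortedE leq_trans) ss2 andbT s2k // ltnW // ltnW.
  split=> [|k kn /= /andP[-> ks1]]; first by rewrite /= s2E mulgA -(thXC mn) -mulgA.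
  by rewrite s2k // (leq_trans kn).
elim: s => [|n s [s1 ss1 s1E]]; first by exists [::].
by have [s2 ss2 [s2E _]] := insert n s1 ss1; exists s2; rewrite //= -s1E.
Qed.

(** The Ore condition for positive words: [thX k] moves left through the inverse letters. At each
    one, the larger of the two indices rises by one, and equal letters cancel. *)
Lemma thP_ore k s : exists p q, (thP s)^-1 * thX k = thP p * (thP q)^-1.
Proof.
elim: s k => [|j s IHs] k.
  by exists [:: k], [::]; rewrite /= invg1 mul1g !mulg1.
rewrite /= invgM -mulgA; have [jk|kj|->] := ltngtP j k; last first.
- by exists [::], s; rewrite /= mulVg mulg1 mul1g.
- have [p [q E]] := IHs k; exists p, (j.+1 :: q).
  by rewrite (thXVC kj) mulgA E /= invgM [RHS]mulgA.
- have [p [q E]] := IHs k.+1; exists p, (j :: q).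
  by rewrite (thXCV jk) mulgA E /= invgM [RHS]mulgA.
Qed.

(** As a = x_0 x_1^-1 and b = x_1, the Ore condition absorbs any generator into a fraction; by
    induction every element of F is a fraction of positive words. *)
Lemma thP_fraction p q l : (l = a) \/ (l = b) \/ (l = a^-1) \/ (l = b^-1) ->
  exists p' q', thP p * (thP q)^-1 * l = thP p' * (thP q')^-1.
Proof.
have b1 : b = thX 1 by rewrite thX1.
have aE : a = thX 0 * (thX 1)^-1 by rewrite -b1 thX0 mulgK.
have mulX r s k : exists r' s', thP r * (thP s)^-1 * thX k = thP r' * (thP s')^-1.
  have [r' [s' E]] := thP_ore k s.
  by exists (r ++ r'), s'; rewrite -mulgA E thP_cat mulgA.
have mulXV r s k :
    exists r' s', thP r * (thP s)^-1 * (thX k)^-1 = thP r' * (thP s')^-1.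
  by exists r, (k :: s); rewrite /= invgM mulgA.
case=> [->|[->|[->|->]]]; rewrite ?b1 //; rewrite aE ?invgM ?invgK mulgA.
  by have [r [s ->]] := mulX p q 0%N; apply: mulXV.
by have [r [s ->]] := mulX p q 1%N; apply: mulXV.
Qed.

End ThompsonGenerators.

Lemma thX_morph (G K : groupType) (phi : UMagmaMorphism.type G K) (a b : G) n :
  phi (thX a b n) = thX (phi a) (phi b) n.
Proof.
case: n => [|n]; first by rewrite !thX0 gmulfM.
by rewrite !thXE gmulfJ gmulfXn gmulfM.
Qed.

Lemma thP_morph (G K : groupType) (phi : UMagmaMorphism.type G K) (a b : G) s :
  phi (thP a b s) = thP (phi a) (phi b) s.
Proof.
by elim: s => [|n s IHs] /=; rewrite ?gmulf1 // gmulfM thX_morph IHs.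
Qed.

(** An element of F is a fraction whose numerator and denominator can be sorted. If it dies in [G],
    faithfulness on sorted words makes the two equal, so it is trivial already. *)
Lemma thompson_isomorphic (G : groupType) (a b : G) :
  commute a (thX a b 2) -> commute a (thX a b 3) ->
  (forall s t, sorted leq s -> sorted leq t -> thP a b s = thP a b t -> s = t) ->
  isomorphic (generated [set a; b]) thompsonF.
Proof.
move=> ab2 ab3 faithful.
pose e (i : 'I_2) := if i == ord0 then a else b.
(* The two commutations are the two relators of F, evaluated at the images of the letters. This
   serves once in [G] and once in the presented group itself. *)
have wv2 (K : groupType) (h : 'I_2 -> K) :
    let x := h ord0 in let y := h ord_max in
    (commute x (thX x y 2) <->
      word_val h (wcomm [:: (ord0, false)] (wconj [:: (ord_max, false)]
        [:: (ord0, false); (ord_max, false)])) = 1) /\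
    (commute x (thX x y 3) <->
      word_val h (wcomm [:: (ord0, false)] (wconj [:: (ord_max, false)]
        ([:: (ord0, false); (ord_max, false)] ++
         [:: (ord0, false); (ord_max, false)]))) = 1).
  move=> x y; rewrite /wcomm /wconj !word_val_cat !word_valV /= /letter_val /=.
  rewrite -/x -/y !mulg1; split; split.
  - by move=> /commgP /eqP; rewrite /commg !thXE /conjg expg1 => <-;
      rewrite !(invgM, mulgA).
  - by move=> E; apply/commgP/eqP; rewrite /commg !thXE /conjg expg1 -E !(invgM, mulgA).
  - by move=> /commgP /eqP; rewrite /commg !thXE /conjg expg2 => <-;
      rewrite !(invgM, mulgA).
  - by move=> E; apply/commgP/eqP; rewrite /commg !thXE /conjg expg2 -E !(invgM, mulgA).
have [|phi phiE] := @pres_lift _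
  [set wcomm [:: (ord0, false)] (wconj [:: (ord_max, false)]
        [:: (ord0, false); (ord_max, false)]);
      wcomm [:: (ord0, false)] (wconj [:: (ord_max, false)]
        ([:: (ord0, false); (ord_max, false)] ++
         [:: (ord0, false); (ord_max, false)]))] G e.
  by have [r2 r3] := wv2 _ e; move=> r [->|->]; [exact: (r2.1 ab2)|exact: (r3.1 ab3)].
have -> : generated [set a; b] = range phi.
  apply/seteqP; split.
    apply: generated_sub; first exact: range_subgroup.
    by move=> x [->|->];
      [exists (pgen _ ord0)|exists (pgen _ ord_max)] => //; rewrite phiE /= mulg1.
  move=> _ [z _ <-]; rewrite -(reprK z) phiE.
  apply: (@subgroup_word_val _ _ e (generated [set a; b])).
    exact: generated_subgroup.
  move=> i; apply: sub_generated; rewrite /e; case: ifP => _; [by left|by right].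
apply: injective_kernel => z.
set K := presented _ in phi phiE z *.
pose x : K := pgen _ ord0; pose y : K := pgen _ ord_max.
have [xy2 xy3] : commute x (thX x y 2) /\ commute x (thX x y 3).
  have [r2 r3] := wv2 K (pgen _).
  by split; [apply/r2|apply/r3]; apply: pres_rel1; [left|right].
have [p [q ->]] : exists p q, z = thP x y p * (thP x y q)^-1.
  elim/presented_ind: z => [|z l [p [q ->]]].
    by exists [::], [::]; rewrite /= invg1 mulg1.
  apply: thP_fraction => //; case: l => i c; rewrite /letter_val /=.
  have : i = ord0 \/ i = ord_max.
    by case: i => -[|[|//]] i2; [left|right]; apply: val_inj.
  by case: c => -[->|->]; rewrite -?/x -?/y; tauto.
have phix : phi x = a by rewrite phiE /= mulg1.
have phiy : phi y = b by rewrite phiE /= mulg1.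
have [p' sp' <-] := thX_sorted xy2 xy3 p.
have [q' sq' <-] := thX_sorted xy2 xy3 q.
rewrite gmulfF !thP_morph phix phiy => /divg1_eq /faithful -> //.
exact: mulgV.
Qed.

Local Close Scope group_scope.
Local Open Scope ring_scope.

(** * Increasing bijections of the line *)

(** Continuity follows from the order, see [la_continuous], so maps can be built from order
    conditions alone. *)
Record lineAut (R : realType) := LineAut {
  la_fun :> R -> R;
  la_inv : R -> R;
  la_funK : cancel la_fun la_inv;
  la_invK : cancel la_inv la_fun;
  la_homo : {homo la_fun : x y / x < y}
}.

Section LineAutGroup.
Variable R : realType.
Implicit Types f g h : lineAut R.

Lemma la_mono f : {mono f : x y / x < y}.
Proof. exact/leW_mono/le_mono/la_homo. Qed.

Lemma la_mono_le f : {mono f : x y / x <= y}.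
Proof. exact/le_mono/la_homo. Qed.

Lemma la_inj f : injective f.
Proof. exact: can_inj (la_funK f). Qed.

Lemma lineAut_eq f g : f =1 g -> f = g.
Proof.
move=> fg; have fg' : la_inv f =1 la_inv g.
  by move=> x; apply: (@la_inj f); rewrite la_invK fg la_invK.
case: f g fg fg' => [f f' a b c] [g g' a' b' c'] /= /funext fg /funext fg'.
by subst; congr LineAut; apply: Prop_irrelevance.
Qed.

Definition la_one : lineAut R :=
  @LineAut R id id (fun=> erefl) (fun=> erefl) (fun _ _ xy => xy).

Program Definition la_mul f g : lineAut R :=
  @LineAut R (f \o g) (la_inv g \o la_inv f) _ _ _.
Next Obligation. by move=> f g; apply: can_comp; apply: la_funK. Qed.
Next Obligation. by move=> f g; apply: can_comp; apply: la_invK. Qed.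
Next Obligation. by move=> f g x y xy; do 2!apply: la_homo. Qed.

Program Definition la_Vg f : lineAut R :=
  LineAut (la_invK f) (la_funK f) _.
Next Obligation. by move=> f x y xy; rewrite -(la_mono f) !la_invK. Qed.

Lemma la_mulA : associative la_mul.
Proof. by move=> f g h; apply: lineAut_eq. Qed.
Lemma la_mul1 : left_id la_one la_mul.
Proof. by move=> f; apply: lineAut_eq. Qed.
Lemma la_mulr1 : right_id la_one la_mul.
Proof. by move=> f; apply: lineAut_eq. Qed.
Lemma la_mulV : left_inverse la_one la_Vg la_mul.
Proof. by move=> f; apply: lineAut_eq => x /=; rewrite la_funK. Qed.
Lemma la_mulVr : right_inverse la_one la_Vg la_mul.
Proof. by move=> f; apply: lineAut_eq => x /=; rewrite la_invK. Qed.

End LineAutGroup.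

HB.instance Definition _ (R : realType) := gen_eqMixin (lineAut R).
HB.instance Definition _ (R : realType) := gen_choiceMixin (lineAut R).
HB.instance Definition _ (R : realType) := isGroup.Build (lineAut R)
  (@la_mulA R) (@la_mul1 R) (@la_mulr1 R) (@la_mulV R) (@la_mulVr R).

Section LineAutTheory.
Variable R : realType.
Implicit Types f g h : lineAut R.

Lemma laM f g x : (f * g)%g x = f (g x). Proof. by []. Qed.

Lemma la1 x : (1%g : lineAut R) x = x. Proof. by []. Qed.

Lemma laK f x : (f^-1)%g (f x) = x. Proof. exact: la_funK. Qed.

Lemma laVK f x : f ((f^-1)%g x) = x. Proof. exact: la_invK. Qed.

Lemma la_eqV f x y : f x = y -> (f^-1)%g y = x.
Proof. by move=> <-; rewrite laK. Qed.

Lemma la_ltV f x y : ((f^-1)%g x < y) = (x < f y).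
Proof. by rewrite -(la_mono f) laVK. Qed.

Lemma la_gtV f x y : (x < (f^-1)%g y) = (f x < y).
Proof. by rewrite -(la_mono f) laVK. Qed.

Lemma la_continuous f : continuous f.
Proof.
move=> x; apply/cvgrPdist_lt => e e0.
have xab : x \in `](f^-1)%g (f x - e), (f^-1)%g (f x + e)[.
  by rewrite in_itv /= la_ltV la_gtV; lra.
near=> z; have : z \in `](f^-1)%g (f x - e), (f^-1)%g (f x + e)[.
  by near: z; apply: near_in_itvoo.
by rewrite in_itv /= la_ltV la_gtV ltr_distlC => /andP[? ?]; lra.
Unshelve. all: by end_near. Qed.

(** * The line as the open unit interval *)

Definition squash (x : R) : R :=
  if 0 <= x then 1 - (2 * (1 + x))^-1 else (2 * (1 - x))^-1.

(** The threshold is [squash 0], where the two rational branches meet. *)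
Definition unsquash (y : R) : R :=
  if 2^-1 <= y then (2 * (1 - y))^-1 - 1 else 1 - (2 * y)^-1.

Lemma squash_itv x : 0 < squash x < 1.
Proof.
rewrite /squash; case: (lerP 0 x) => x0.
  have : 0 < (2 * (1 + x))^-1 <= 2^-1.
    by rewrite invr_gt0 lef_pV2 ?posrE; lra.
  by move=> /andP[]; lra.
have : 0 < (2 * (1 - x))^-1 <= 2^-1.
  by rewrite invr_gt0 lef_pV2 ?posrE; lra.
by move=> /andP[]; lra.
Qed.

Lemma squashK : cancel squash unsquash.
Proof.
move=> x; rewrite /squash; case: (lerP 0 x) => x0; rewrite /unsquash.
  rewrite ifT; first by field; apply/andP; split; lra.
  have : (2 * (1 + x))^-1 <= 2^-1 by rewrite lef_pV2 ?posrE; lra.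
  by lra.
rewrite ifF; first by field; lra.
apply/negbTE; rewrite -ltNge.
by rewrite ltf_pV2 ?posrE; lra.
Qed.

Lemma unsquashK y : 0 < y < 1 -> squash (unsquash y) = y.
Proof.
move=> /andP[y0 y1]; rewrite /unsquash; case: (lerP 2^-1 y) => y2; rewrite /squash.
  rewrite ifT; first by field; apply/andP; split; lra.
  rewrite subr_ge0 -invr1 lef_pV2 ?posrE; lra.
rewrite ifF; first by field; lra.
apply/negbTE; rewrite -ltNge subr_lt0.
by rewrite -[X in X < _]invr1 ltf_pV2 ?posrE; lra.
Qed.

Lemma squash_homo : {homo squash : x y / x < y}.
Proof.
move=> x y xy; rewrite /squash; case: (lerP 0 x) => x0; case: (lerP 0 y) => y0.
- by rewrite ltrD2l ltrN2 ltf_pV2 ?posrE; lra.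
- by lra.
- have : (2 * (1 - x))^-1 < 2^-1 by rewrite ltf_pV2 ?posrE; lra.
  have : (2 * (1 + y))^-1 <= 2^-1 by rewrite lef_pV2 ?posrE; lra.
  by lra.
- by rewrite ltf_pV2 ?posrE; lra.
Qed.

Lemma squash_mono : {mono squash : x y / x < y}.
Proof. exact/leW_mono/le_mono/squash_homo. Qed.

Lemma unsquash_homo x y : 0 < x < 1 -> 0 < y < 1 -> x < y -> unsquash x < unsquash y.
Proof. by move=> x01 y01 xy; rewrite -squash_mono !unsquashK. Qed.

Definition squashed (h : R -> R) (y : R) : R :=
  if 0 < y < 1 then squash (h (unsquash y)) else y.

Lemma squashed_comp (h k : R -> R) : squashed h \o squashed k =1 squashed (h \o k).
Proof.
move=> y; rewrite /squashed /=.
by have [y01|/negbTE y01] := boolP (0 < y < 1); rewrite ?squash_itv ?squashK ?y01.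
Qed.

Lemma squashedK (h k : R -> R) : cancel h k -> cancel (squashed h) (squashed k).
Proof.
move=> hk y; rewrite [LHS](squashed_comp k h) /squashed.
by case: ifP => // y01; rewrite /= hk unsquashK.
Qed.

Lemma squashed_homo (h : R -> R) :
  {homo h : x y / x < y} -> {homo squashed h : x y / x < y}.
Proof.
move=> hh x y xy; rewrite /squashed.
case: ifP => x01; case: ifP => y01 //.
- exact/squash_homo/hh/unsquash_homo.
- have /andP[? ?] := squash_itv (h (unsquash x)).
  move/andP: x01 => [? ?]; move/negbT: y01; rewrite negb_and -!leNgt.
  by move=> /orP[?|?]; lra.
- have /andP[? ?] := squash_itv (h (unsquash y)).
  move/andP: y01 => [? ?]; move/negbT: x01; rewrite negb_and -!leNgt.
  by move=> /orP[?|?]; lra.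
Qed.

(** Extending by the identity outside (0, 1) gives a bijection of the whole line again, so that
    continuity up to the endpoints 0 and 1 comes from [la_continuous]. *)
Definition la_squashed f : lineAut R :=
  LineAut (squashedK (la_funK f)) (squashedK (la_invK f))
    (squashed_homo (@la_homo _ f)).

Lemma squashed01 (h : R -> R) y :
  `[0, 1]%classic y -> `[0, 1]%classic (squashed h y).
Proof.
rewrite /squashed => y01; case: ifP => // _ /=; rewrite in_itv /=.
by have /andP[/ltW -> /ltW ->] := squash_itv (h (unsquash y)).
Qed.

Definition on_unitI (h : R -> R) (y : unitI R) : unitI R :=
  SigSub (mem_set (squashed01 h (set_valP y))).

Lemma on_unitIK (h k : R -> R) : cancel h k -> cancel (on_unitI h) (on_unitI k).
Proof. by move=> hk y; apply: val_inj; apply: squashedK. Qed.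

Lemma on_unitI_continuous f : continuous (on_unitI f).
Proof.
apply: continuous_comp_initial => x.
apply: (@continuous_comp _ _ _ set_val (la_squashed f)).
  exact: initial_continuous.
exact: la_continuous.
Qed.

Definition homeo_of f : homeoI R :=
  HomeoI (on_unitIK (la_funK f)) (on_unitIK (la_invK f))
    (@on_unitI_continuous f) (@on_unitI_continuous (f^-1)%g)
    (fun x y => squashed_homo (@la_homo _ f) (x := set_val x) (y := set_val y)).

Lemma homeo_ofM f g : homeo_of (f * g)%g = (homeo_of f * homeo_of g)%g.
Proof.
apply: homeoI_eq => y; apply: val_inj; apply: esym.
exact: (squashed_comp f g).
Qed.

Lemma squash_unitI x : `[0, 1]%classic (squash x).
Proof. by have /andP[/ltW a /ltW b] := squash_itv x; rewrite /= in_itv /= a. Qed.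

Definition sqI (x : R) : unitI R := SigSub (mem_set (squash_unitI x)).

Lemma homeo_of_sqI f x : homeo_of f (sqI x) = sqI (f x).
Proof.
by apply: val_inj; rewrite /= /squashed squash_itv squashK.
Qed.

Lemma sqI_inj : injective sqI.
Proof. by move=> x y /(congr1 val) /(can_inj squashK). Qed.

Lemma homeo_of_inj : injective homeo_of.
Proof.
move=> f g fg; apply: lineAut_eq => x; apply: sqI_inj.
by rewrite -!homeo_of_sqI fg.
Qed.

Lemma supp_homeo_of f : supp (homeo_of f) = squash @` [set x | f x <> x].
Proof.
apply/seteqP; split=> [_ [y /= /eqP fy <-]|_ [x /= fx <-]].
  have [y01|y01] := boolP (0 < set_val y < 1); last first.
    by case: fy; apply: val_inj; rewrite /= /squashed (negbTE y01).
  exists (unsquash (set_val y)); last exact: unsquashK.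
  move=> fE; apply: fy; apply: val_inj.
  by rewrite /= /squashed y01 fE unsquashK.
exists (sqI x) => //; change (homeo_of f (sqI x) != sqI x).
by apply/eqP; rewrite homeo_of_sqI => /sqI_inj.
Qed.

End LineAutTheory.

Section IntegerPowers.
Variables (G : groupType) (S : G).

Definition zpow (n : int) : G :=
  match n with Posz k => (S ^+ k)%g | Negz k => (S ^- k.+1)%g end.

Lemma zpow0 : zpow 0 = 1%g. Proof. by []. Qed.

Lemma zpow1 : zpow 1 = S. Proof. by rewrite /= expg1. Qed.

Lemma zpowS (n : int) : zpow (n + 1) = (S * zpow n)%g.
Proof.
case: n => [k|[|k]]; first by rewrite -PoszD addn1 /= expgS.
  by rewrite /= expg1 mulgV.
have -> : Negz k.+1 + 1 = Negz k by lia.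
by rewrite /= (expgSr S k.+1) invgM mulVKg.
Qed.

Lemma zpowD (m n : int) : zpow (m + n) = (zpow m * zpow n)%g.
Proof.
elim/int_rect: m => [|k IHk|k IHk]; first by rewrite add0r mul1g.
  rewrite -addn1 PoszD addrAC !zpowS IHk mulgA.
  by congr (_ * _)%g.
apply: (mulgI S); rewrite -zpowS mulgA -zpowS.
have -> : - k.+1%:Z + n + 1 = - k%:Z + n by lia.
by have -> : - k.+1%:Z + 1 = - k%:Z by lia.
Qed.

Lemma zpowN (n : int) : zpow (- n) = (zpow n)^-1%g.
Proof. by apply/esym/mulg1_eq; rewrite -zpowD subrr. Qed.

End IntegerPowers.

Lemma zpow_subgroup (G : groupType) (H : set G) (S : G) n :
  is_subgroup H -> H S -> H (zpow S n).
Proof.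
move=> sH HS; have HX k : H (S ^+ k)%g.
  elim: k => [|k IHk]; first exact: subgroup1.
  by rewrite expgS; apply: subgroupM.
by case: n => k; [apply: HX|apply: subgroupV].
Qed.

(** * Maps acting like translations on an interval *)

Section RightMoving.
Variable R : realType.
Implicit Types (J : set R) (S : lineAut R).

Record right_moving J S : Prop := RightMoving {
  rm_itv : is_interval J;
  rm_fwd : forall x, J x -> J (S x);
  rm_bwd : forall x, J x -> J ((S^-1)%g x);
  rm_lt : forall x, J x -> x < S x
}.

Lemma rm_zpow J S n x : right_moving J S -> J x -> J (zpow S n x).
Proof.
move=> [_ fwd bwd _] Jx; elim/int_rect: n => [//|k IHk|k IHk].
  by rewrite -addn1 PoszD zpowS; apply: fwd.
have -> : zpow S (- k.+1%:Z) = (S^-1 * zpow S (- k%:Z))%g.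
  by apply/esym/(canLR (mulKg _)); rewrite -zpowS; congr zpow; lia.
exact: bwd.
Qed.

Lemma rm_zpow_le J S m n x : right_moving J S -> J x -> m <= n ->
  zpow S m x <= zpow S n x.
Proof.
move=> rm Jx mn; have -> : n = m + `|n - m|%N by lia.
elim: `|n - m|%N => [|k IHk]; first by rewrite addr0.
apply: le_trans IHk _; rewrite -addn1 PoszD addrA zpowS laM.
by apply/ltW/(rm_lt rm); apply: rm_zpow.
Qed.

(** A bounded orbit would have its supremum in [J]. Its preimage under [S] is smaller, so some orbit
    point exceeds that preimage, and the next orbit point exceeds the supremum. *)
Lemma rm_cofinal J S x y : right_moving J S -> J x -> J y ->
  exists n : nat, y < zpow S n x.
Proof.
move=> rm Jx Jy; apply: contrapT => /forallNP ny.
have {}ny n : zpow S (Posz n) x <= y by rewrite leNgt; apply/negP/ny.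
pose O := [set zpow S (Posz n) x | n in [set: nat]].
have Oub : ubound O y by move=> _ [n _ <-].
have O0 : O !=set0 by exists x, 0%N.
have Osup : has_sup O by split=> //; exists y.
have Jz : J (sup O).
  apply: (rm_itv rm Jx Jy); rewrite ge_sup // andbT.
  by apply: ub_le_sup; [exists y|exists 0%N].
have SzE : 0 < sup O - (S^-1)%g (sup O).
  by rewrite subr_gt0 la_ltV; apply: (rm_lt rm).
have [_ [n _ <-]] := sup_adherent SzE Osup.
rewrite subKr la_ltV -laM -zpowS -PoszD => /lt_geF /negP; apply.
by apply: ub_le_sup; [exists y|exists (n + 1)%N].
Qed.

Lemma zpow_lt_shift S (n : int) x y : (zpow S n x < y) = (x < zpow S (- n) y).
Proof. by rewrite zpowN la_gtV. Qed.

Lemma zpow_le_shift S (n : int) x y : (zpow S n x <= y) = (x <= zpow S (- n) y).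
Proof. by rewrite zpowN -[RHS](la_mono_le (zpow S n)) laVK. Qed.

Lemma zpowK S n x : zpow S (- n) (zpow S n x) = x.
Proof. by rewrite zpowN laK. Qed.

Lemma zpowVK S n x : zpow S n (zpow S (- n) x) = x.
Proof. by rewrite zpowN laVK. Qed.

(** Translates of a fundamental domain, half-open so that they partition [J]. *)
Definition in_cell S x0 (n : int) x := zpow S n x0 <= x < zpow S (n + 1) x0.

Lemma in_cellE S x0 n x : in_cell S x0 n x = (x0 <= zpow S (- n) x < S x0).
Proof.
rewrite /in_cell zpow_le_shift; congr (_ && _).
by rewrite [RHS]zpow_lt_shift opprK zpowD zpow1.
Qed.

Lemma in_cell_ex J S x0 x : right_moving J S -> J x0 -> J x ->
  exists n, in_cell S x0 n x.
Proof.
move=> rm Jx0 Jx; have [m mP] := rm_cofinal rm Jx Jx0.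
have x0x : zpow S (- m%:Z) x0 < x by rewrite zpow_lt_shift opprK.
(* Shifting by [m] makes the exponents natural numbers, among which a least one exists. *)
have kP : exists k : nat, x < zpow S (k%:Z - m%:Z) x0.
  have [k kP] := rm_cofinal rm Jx0 Jx; exists (k + m)%N.
  by rewrite PoszD addrK.
case: (ex_minnP kP) => -[|k]; first by rewrite sub0r ltNge (ltW x0x).
move=> xk kmin; exists (k%:Z - m%:Z); rewrite /in_cell leNgt.
have -> : k%:Z - m%:Z + 1 = k.+1%:Z - m%:Z by lia.
by rewrite xk andbT; apply/negP => /kmin; rewrite ltnn.
Qed.

Lemma in_cell_le J S x0 m n x y : right_moving J S -> J x0 ->
  in_cell S x0 m x -> in_cell S x0 n y -> x <= y -> m <= n.
Proof.
move=> rm Jx0 /andP[mx _] /andP[_ yn] xy; rewrite leNgt; apply/negP => nm.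
have := le_lt_trans mx (le_lt_trans xy yn); apply/negP; rewrite -leNgt.
by apply: rm_zpow_le rm Jx0 _; lia.
Qed.

Lemma in_cell_uniq J S x0 m n x : right_moving J S -> J x0 ->
  in_cell S x0 m x -> in_cell S x0 n x -> m = n.
Proof.
by move=> rm Jx0 mx nx; apply/eqP; rewrite eq_le !(in_cell_le rm Jx0 _ _ (lexx x)).
Qed.

(** * Equivariant extension from a fundamental domain *)

Section EquivariantExtension.
Variable J : set R.

(** The map that agrees with [beta] on the cell of index 0 and intertwines [S] with [S'] on [J]. The
    default 0 of [xget] is not reached when [S] is right-moving on [J] and [x0] is in [J]. *)
Definition eqv_fun S S' (beta : R -> R) x0 x : R :=
  if `[< J x >] then
    let n := xget 0 [set n | in_cell S x0 n x] in zpow S' n (beta (zpow S (- n) x))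
  else x.

Lemma eqv_funE S S' beta x0 n x : right_moving J S -> J x0 -> J x ->
  in_cell S x0 n x -> eqv_fun S S' beta x0 x = zpow S' n (beta (zpow S (- n) x)).
Proof.
move=> rm Jx0 Jx nx; rewrite /eqv_fun asboolT //=.
case: xgetP => [k _ kx|/(_ n)//]; first by rewrite (in_cell_uniq rm Jx0 kx nx).
Qed.

Section Values.
Variables (S S' beta : lineAut R) (x0 : R).
Hypotheses (rmS : right_moving J S) (rmS' : right_moving J S').
Hypotheses (Jx0 : J x0) (Jb0 : J (beta x0)) (betaS : beta (S x0) = S' (beta x0)).

Lemma eqv_fun_cell n x : J x -> in_cell S x0 n x ->
  J (eqv_fun S S' beta x0 x) /\
  in_cell S' (beta x0) n (eqv_fun S S' beta x0 x).
Proof.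
move=> Jx nx; rewrite (eqv_funE _ _ rmS Jx0 Jx nx).
have /andP[a b] : in_cell S' (beta x0) n (zpow S' n (beta (zpow S (- n) x))).
  rewrite in_cellE zpowK -betaS (la_mono_le beta) (la_mono beta).
  by rewrite -in_cellE.
split; last by apply/andP.
apply: (rm_itv rmS') (rm_zpow n rmS' Jb0) (rm_zpow (n + 1) rmS' Jb0) _ _.
by rewrite a ltW.
Qed.

Lemma eqv_funJ x : J x -> J (eqv_fun S S' beta x0 x).
Proof.
by move=> Jx; have [n /(eqv_fun_cell Jx)[]] := in_cell_ex rmS Jx0 Jx.
Qed.

Lemma eqv_funN x : ~ J x -> eqv_fun S S' beta x0 x = x.
Proof. by move=> Jx; rewrite /eqv_fun asboolF. Qed.

Lemma eqv_fun_homo : {homo eqv_fun S S' beta x0 : x y / x < y}.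
Proof.
move=> x y xy; have [Jx|Jx] := pselect (J x); have [Jy|Jy] := pselect (J y).
- have [n nx] := in_cell_ex rmS Jx0 Jx; have [m my] := in_cell_ex rmS Jx0 Jy.
  have := in_cell_le rmS Jx0 nx my (ltW xy); rewrite le_eqVlt => /predU1P[nm|nm].
    rewrite (eqv_funE _ _ rmS Jx0 Jx nx) (eqv_funE _ _ rmS Jx0 Jy my) nm.
    by rewrite !la_mono.
  have [_ /andP[_ xn]] := eqv_fun_cell Jx nx.
  have [_ /andP[ym _]] := eqv_fun_cell Jy my.
  apply: (lt_le_trans xn); apply: le_trans ym.
  by apply: rm_zpow_le rmS' Jb0 _; lia.
- rewrite (eqv_funN Jy) ltNge; apply/negP => yx; apply: Jy.
  by apply: (rm_itv rmS Jx (eqv_funJ Jx)); rewrite (ltW xy).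
- rewrite (eqv_funN Jx) ltNge; apply/negP => yx; apply: Jx.
  by apply: (rm_itv rmS (eqv_funJ Jy) Jy); rewrite (ltW xy) yx.
- by rewrite !eqv_funN.
Qed.

End Values.

(** Cells go to cells of the same index, so the inverse is the same construction with [S] and [S']
    exchanged, from the base point [beta x0]. *)
Lemma eqv_funK S S' (beta : lineAut R) x0 : right_moving J S -> right_moving J S' ->
  J x0 -> J (beta x0) -> beta (S x0) = S' (beta x0) ->
  cancel (eqv_fun S S' beta x0) (eqv_fun S' S (beta^-1)%g (beta x0)).
Proof.
move=> rm rm' Jx0 Jb0 bS x; have [Jx|Jx] := pselect (J x); last first.
  by rewrite !eqv_funN.
have [n nx] := in_cell_ex rm Jx0 Jx.
have [Jy ny] := eqv_fun_cell rm rm' Jx0 Jb0 bS Jx nx.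
rewrite (eqv_funE _ _ rm' Jb0 Jy ny) (eqv_funE _ _ rm Jx0 Jx nx).
by rewrite zpowK laK zpowVK.
Qed.

(** The condition at [S x0] makes the translated pieces fit together. The lemma yields the roots,
    the conjugacy between right-moving maps, and the hyperbolic map. *)
Lemma equivariant_extension S S' (beta : lineAut R) x0 :
  right_moving J S -> right_moving J S' ->
  J x0 -> J (beta x0) -> beta (S x0) = S' (beta x0) ->
  exists phi : lineAut R,
    [/\ forall x, ~ J x -> phi x = x,
        forall x, J x -> J (phi x),
        forall x, J x -> J ((phi^-1)%g x),
        forall x, J x -> phi (S x) = S' (phi x) &
        forall x, x0 <= x <= S x0 -> phi x = beta x].
Proof.
move=> rm rm' Jx0 Jb0 bS.
have Jb0' : J ((beta^-1)%g (beta x0)) by rewrite laK.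
have bS' : (beta^-1)%g (S' (beta x0)) = S ((beta^-1)%g (beta x0)).
  by rewrite -bS !laK.
have fK := eqv_funK rm rm' Jx0 Jb0 bS.
have gK : cancel (eqv_fun S' S (beta^-1)%g (beta x0)) (eqv_fun S S' beta x0).
  by have := eqv_funK rm' rm Jb0 Jb0' bS'; rewrite invgK laK.
exists (LineAut fK gK (eqv_fun_homo rm rm' Jx0 Jb0 bS)).
have phiS x : J x -> eqv_fun S S' beta x0 (S x) = S' (eqv_fun S S' beta x0 x).
  move=> Jx; have [n nx] := in_cell_ex rm Jx0 Jx.
  have SxE : zpow S (- (n + 1)) (S x) = zpow S (- n) x.
    by rewrite -{2}(zpow1 S) -laM -zpowD; congr (la_fun (zpow S _) x); lia.
  have nSx : in_cell S x0 (n + 1) (S x) by rewrite in_cellE SxE -in_cellE.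
  rewrite (eqv_funE _ _ rm Jx0 Jx nx) (eqv_funE _ _ rm Jx0 (rm_fwd rm Jx) nSx).
  by rewrite SxE zpowS.
have phib x : x0 <= x < S x0 -> eqv_fun S S' beta x0 x = beta x.
  move=> /andP[a b]; have c0 : in_cell S x0 0 x by rewrite in_cellE /= a.
  have Jx : J x by apply: (rm_itv rm Jx0 (rm_fwd rm Jx0)); rewrite a ltW.
  by rewrite (eqv_funE _ _ rm Jx0 Jx c0).
split=> [x Jx|x Jx|x Jx|//|x /andP[a]] /=.
- by rewrite eqv_funN.
- exact: eqv_funJ.
- exact: (eqv_funJ rm' rm Jb0 Jb0' bS').
(* The endpoint [S x0] belongs to the next cell; there the value comes from equivariance. *)
- rewrite le_eqVlt => /predU1P[->|b]; last by apply: phib; rewrite a.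
  by rewrite phiS // phib ?bS // lexx (rm_lt rm).
Qed.

End EquivariantExtension.

Section Gluing.
Variables (p : R) (f g : lineAut R).
Hypothesis fgp : f p = g p.

Definition glue_fun (f g : R -> R) (p x : R) : R := if x < p then f x else g x.

Lemma glue_funK (h k : lineAut R) : h p = k p ->
  cancel (glue_fun h k p) (glue_fun (h^-1)%g (k^-1)%g (h p)).
Proof.
move=> hk x; rewrite /glue_fun; case: (ltrP x p) => xp.
  by rewrite la_mono xp laK.
by rewrite hk la_mono ltNge xp laK.
Qed.

Lemma glue_homo : {homo glue_fun f g p : x y / x < y}.
Proof.
move=> x y xy; rewrite /glue_fun; case: (ltrP x p) => xp; case: (ltrP y p) => yp.
- by rewrite la_mono.
- by apply: (@lt_le_trans _ _ (f p)); rewrite ?la_mono // fgp la_mono_le.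
- by have := le_lt_trans xp (lt_trans xy yp); rewrite ltxx.
- by rewrite la_mono.
Qed.

Lemma glue_invK : cancel (glue_fun (f^-1)%g (g^-1)%g (f p)) (glue_fun f g p).
Proof.
move=> y; rewrite /glue_fun; case: (ltrP y (f p)) => yp.
  by rewrite la_ltV yp laVK.
by rewrite la_ltV -fgp ltNge yp laVK.
Qed.

Definition la_glue : lineAut R := LineAut (glue_funK fgp) glue_invK glue_homo.

Lemma la_glue_lt x : x < p -> la_glue x = f x.
Proof. by rewrite /= /glue_fun => ->. Qed.

Lemma la_glue_ge x : p <= x -> la_glue x = g x.
Proof. by rewrite /= /glue_fun ltNge => ->. Qed.

End Gluing.

Section Affine.
Variables (c : R) (c0 : 0 < c) (d : R).

Lemma affineK : cancel (fun x => c * x + d) (fun y => c^-1 * (y - d)).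
Proof. by move=> x; rewrite addrK mulKf // gt_eqF. Qed.

Lemma affineVK : cancel (fun y => c^-1 * (y - d)) (fun x => c * x + d).
Proof. by move=> x; rewrite mulVKf ?subrK // gt_eqF. Qed.

Lemma affine_homo : {homo (fun x => c * x + d) : x y / x < y}.
Proof. by move=> x y xy; rewrite ltrD2r ltr_pM2l. Qed.

Definition affine : lineAut R := LineAut affineK affineVK affine_homo.

Lemma affineE x : affine x = c * x + d. Proof. by []. Qed.

End Affine.

End RightMoving.

Section Conjugation.
Variable R : realType.
Implicit Types (f g K S theta : lineAut R) (J Z : set R).

Lemma commute_half_lines f g p :
  (forall x, x <= p -> g x = x) -> (forall x, p <= x -> f x = x) -> commute f g.
Proof.
move=> gp fp; apply: lineAut_eq => x; rewrite !laM.
have [xp|/ltW px] := lerP x p.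
  by rewrite gp // gp // -(fp p) // la_mono_le.
by rewrite [in RHS]fp // fp // -(gp p) // la_mono_le.
Qed.

(** Conjugating [K] by [f] depends only on the values of [f] on a set containing the support of
    [K]. *)
Lemma conj_agree f theta K Z :
  (forall x, ~ Z x -> K x = x) -> (forall x, Z x -> Z (K x)) ->
  (forall x, Z x -> f x = theta x) -> (f * K * f^-1 = theta * K * theta^-1)%g.
Proof.
move=> KN KZ ft; apply: (canLR (mulgK _)); apply: lineAut_eq => x; rewrite !laM.
have [Zx|Zx] := pselect (Z x); first by rewrite !ft ?laK //; apply: KZ.
(* For x outside [Z], the point w = theta^-1 (f x) cannot be in [Z]: there f w = theta w = f x, so
   that w = x. *)
have [Zw|Zw] := pselect (Z ((theta^-1)%g (f x))); last first.
  by rewrite !KN // laVK.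
by have := ft _ Zw; rewrite laVK => /la_inj wx; case: Zx; rewrite -wx.
Qed.

Lemma rm_expg J S n : right_moving J S -> right_moving J (S ^+ n.+1)%g.
Proof.
move=> rm; split=> [|x Jx|x Jx|x Jx]; first exact: rm_itv rm.
- exact: (rm_zpow n.+1 rm Jx).
- have := rm_zpow (- n.+1%:Z) rm Jx.
  by rewrite zpowN.
- apply: (lt_le_trans (rm_lt rm Jx)); rewrite -{1}(zpow1 S).
  by apply: (@rm_zpow_le _ J S 1 n.+1); rewrite ?lez_nat.
Qed.

Lemma rm_between (a b : R) S : S a = a -> S b = b ->
  (forall x, a < x < b -> x < S x) -> right_moving [set x | a < x < b] S.
Proof.
move=> Sa Sb Sx; split=> [x y /= xab yab z|x /= /andP[ax xb]|x /= /andP[ax xb]|//].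
- by move: xab yab => /andP[? ?] /andP[? ?] /andP[? ?] /=; apply/andP; split; lra.
- by rewrite -{1}Sa -{1}Sb !la_mono ax.
- by rewrite la_gtV la_ltV Sa Sb ax.
Qed.

Lemma zpow_equivariant J S S' f n x : right_moving J S ->
  (forall x, J x -> f (S x) = S' (f x)) -> J x ->
  f (zpow S n x) = zpow S' n (f x).
Proof.
move=> rm fS Jx; elim/int_rect: n => [//|k IHk|k IHk].
  by rewrite -addn1 PoszD !zpowS !laM fS ?IHk //; apply: rm_zpow.
apply: (@la_inj _ S'); rewrite -fS; last exact: rm_zpow.
rewrite -[X in f X]laM -[RHS]laM -!zpowS.
by have -> : - k.+1%:Z + 1 = - k%:Z by lia.
Qed.

(* A root of [S] is prescribed freely on the first half [p, theta p] of a
   fundamental domain [p, S p], and it equals [S * theta^-1] on the second. *)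
Lemma square_root_extension J S theta p :
  right_moving J S -> (forall x, ~ J x -> S x = x) -> J p -> p < theta p ->
  theta (theta p) = S p ->
  exists f, [/\ (f ^+ 2)%g = S, [set x | f x <> x] = J &
    forall x, p <= x <= theta p -> f x = theta x].
Proof.
move=> rm SN Jp pq qS; set q := theta p in pq qS *.
have qSp : q < S p by rewrite -qS la_mono.
have Jq : J q by apply: (rm_itv rm Jp (rm_fwd rm Jp)); rewrite !ltW.
(* At q = theta p both branches take the value S p. *)
have gl : theta q = (S * theta^-1)%g q by rewrite laM laK.
pose beta := la_glue gl.
have bp : beta p = q by rewrite /beta la_glue_lt.
have [||f [fN fJ _ fS fb]] := @equivariant_extension _ J S S beta p rm rm Jp.
- by rewrite bp.
- by rewrite bp /beta la_glue_ge ?(ltW qSp) // laM -qS laK.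
have f2 : (f ^+ 2)%g = S.
  apply: lineAut_eq => x; rewrite expg2 laM.
  have [Jx|Jx] := pselect (J x); last by rewrite !fN ?SN.
  have [n] := in_cell_ex rm Jp Jx; rewrite in_cellE.
  have := zpowVK S n x; set y := zpow S (- n) x => xE /andP[py yS].
  have Jy : J y by apply: rm_zpow.
  rewrite -xE !(zpow_equivariant n rm fS) //; last exact: fJ.
  have -> : S (zpow S n y) = zpow S n (S y) by rewrite -!laM -zpowS zpowD zpow1.
  congr (la_fun (zpow S n) _).
  (* On the first half, f sends y to theta y in the second half, where S theta^-1 brings it to S y.
     On the second half, f y = S z with z = theta^-1 y in the first half, and f commutes with S, so
     f (f y) = S (theta z) = S y. *)
  have [yq|qy] := ltrP y q.
    have fy : f y = theta y by rewrite fb ?py ?ltW // /beta la_glue_lt.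
    have qty : q <= theta y by rewrite /q la_mono_le.
    have qtyS : p <= theta y <= S p.
      by rewrite (le_trans (ltW pq) qty) -qS la_mono_le ltW.
    by rewrite fy (fb _ qtyS) /beta la_glue_ge // laM laK.
  have fy : f y = S ((theta^-1)%g y).
    by rewrite fb ?py ?ltW // /beta la_glue_ge.
  rewrite fy.
  have pz : p <= (theta^-1)%g y by rewrite leNgt la_ltV -leNgt.
  have zq : (theta^-1)%g y < q by rewrite la_ltV qS.
  have Jz : J ((theta^-1)%g y).
    by apply: (rm_itv rm Jp Jq); rewrite pz ltW.
  rewrite fS // fb ?pz ?(ltW (lt_trans zq _)) //.
  by rewrite /beta la_glue_lt // laVK.
exists f; split=> //.
- apply/seteqP; split=> x; first by move=> fx; apply: contrapT => /fN.
  move=> Jx fx; have := rm_lt rm Jx.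
  by rewrite -f2 expg2 laM !fx ltxx.
- move=> x /andP[px xq]; rewrite fb ?px ?(le_trans xq (ltW qSp)) // /beta.
  have [xq'|qx] := ltrP x q; first by rewrite la_glue_lt.
  by rewrite la_glue_ge // (le_anti (introT andP (conj xq qx))) -gl.
Qed.

End Conjugation.

(** * Thompson's group on the line *)

Section ThompsonOnTheLine.
Variable R : realType.

Lemma half_gt0 : (0 : R) < 2^-1. Proof. by rewrite invr_gt0. Qed.

Lemma thA_glue0 : (1%g : lineAut R) 0 = affine (ltr0Sn R 1) 0 0.
Proof. by rewrite affineE la1; lra. Qed.

Lemma thA_glue1 : la_glue thA_glue0 1 = affine (@ltr01 R) 1 1.
Proof. by rewrite la_glue_ge ?ler01 // !affineE; lra. Qed.

Definition thA : lineAut R := la_glue thA_glue1.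

Lemma thA_le0 x : x <= 0 -> thA x = x.
Proof.
move=> x0; rewrite /thA la_glue_lt; last by lra.
case: (ltrP x 0) => x0'; first by rewrite la_glue_lt.
by rewrite la_glue_ge // affineE; lra.
Qed.

Lemma thA_01 x : 0 <= x <= 1 -> thA x = 2 * x.
Proof.
move=> /andP[x0 x1]; rewrite /thA; case: (ltrP x 1) => x1'.
  by rewrite la_glue_lt // la_glue_ge // affineE; lra.
by rewrite la_glue_ge // affineE; lra.
Qed.

Lemma thA_ge1 x : 1 <= x -> thA x = x + 1.
Proof. by move=> x1; rewrite /thA la_glue_ge // affineE; lra. Qed.

Lemma thB_glueN1 : affine (@ltr01 R) 1 (-1) = affine half_gt0 2^-1 (-1).
Proof. by rewrite !affineE; lra. Qed.

Lemma thB_glue1 : la_glue thB_glueN1 1 = (1%g : lineAut R) 1.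
Proof. by rewrite la_glue_ge ?affineE ?la1; lra. Qed.

Definition thB : lineAut R := la_glue thB_glue1.

Lemma thB_leN1 x : x <= -1 -> thB x = x + 1.
Proof.
move=> x0; rewrite /thB la_glue_lt; last by lra.
case: (ltrP x (-1)) => x0'; first by rewrite la_glue_lt // affineE; lra.
by rewrite la_glue_ge // affineE; lra.
Qed.

Lemma thB_mid x : -1 <= x <= 1 -> thB x = (x + 1) / 2.
Proof.
move=> /andP[x0 x1]; rewrite /thB; case: (ltrP x 1) => x1'.
  by rewrite la_glue_lt // la_glue_ge // affineE; lra.
by rewrite la_glue_ge // la1; lra.
Qed.

Lemma thB_ge1 x : 1 <= x -> thB x = x.
Proof. by move=> x1; rewrite /thB la_glue_ge. Qed.

(** On [-1, 1] the slope 1/2 of [thB] is undone by the slope 2 of [thA] on [0, 1]; elsewhere one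
    factor acts as the identity and the other as the translation. *)
Lemma thAB x : (thA * thB)%g x = x + 1.
Proof.
rewrite laM; case: (lerP x (-1)) => xN1.
  by rewrite thB_leN1 // thA_le0; lra.
case: (lerP x 1) => x1.
  by rewrite thB_mid ?thA_01; apply/andP || idtac; lra.
by rewrite thB_ge1 ?thA_ge1; lra.
Qed.

Lemma thABX n x : ((thA * thB) ^+ n)%g x = x + n%:R.
Proof.
elim: n => [|n IHn]; first by rewrite addr0.
by rewrite expgS laM IHn thAB -addrA -natr1.
Qed.

(** Conjugation by the translation moves the support of [thB] to the left by n, onto (-oo, 1 -
    n). *)
Lemma thX_line n y : thX thA thB n.+1 y = thB (y + n%:R) - n%:R.
Proof.
rewrite thXE /conjg !laM; apply: la_eqV.
by rewrite !thABX subrK.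
Qed.

Lemma thA_gt x : 0 < x -> x < thA x.
Proof.
move=> x0; case: (lerP x 1) => x1; first by rewrite thA_01 ?(ltW x0) //; lra.
by rewrite thA_ge1; lra.
Qed.

Lemma thB_gt x : x < 1 -> x < thB x.
Proof.
move=> x1; case: (lerP x (-1)) => xN1; first by rewrite thB_leN1 //; lra.
by rewrite thB_mid ?(ltW xN1) ?(ltW x1) //; lra.
Qed.

Lemma thB_ge x : x <= thB x.
Proof. by case: (lerP 1 x) => [/thB_ge1 ->//|/thB_gt/ltW]. Qed.

Lemma thX_line_ge n y : y <= thX thA thB n y.
Proof.
case: n => [|n]; first by rewrite thX0 thAB; lra.
by rewrite thX_line; have := thB_ge (y + n%:R); lra.
Qed.

Lemma thX_line_gt n : 1 - n%:R < thX thA thB n (1 - n%:R).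
Proof.
case: n => [|n]; first by rewrite thX0 thAB; lra.
have n1 : n.+1%:R = n%:R + 1 :> R by rewrite natr1.
by rewrite thX_line; have := @thB_gt (1 - n.+1%:R + n%:R); lra.
Qed.

Lemma thX_line_fix m n : (n < m)%N -> thX thA thB m (1 - n%:R) = 1 - n%:R.
Proof.
case: m => [//|m] nm; rewrite thX_line thB_ge1; first by lra.
have : n%:R <= m%:R :> R by rewrite ler_nat.
by lra.
Qed.

Lemma thP_line_cons n s y :
  thP thA thB (n :: s) y = thX thA thB n (thP thA thB s y).
Proof. by []. Qed.

Lemma thP_line_ge s y : y <= thP thA thB s y.
Proof.
elim: s => [//|n s IHs]; rewrite thP_line_cons.
exact/(le_trans IHs)/thX_line_ge.
Qed.

Lemma thP_line_fix n s : all (ltn n) s -> thP thA thB s (1 - n%:R) = 1 - n%:R.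
Proof.
elim: s => [//|m s IHs] /andP[nm ns]; rewrite thP_line_cons IHs //.
exact: thX_line_fix.
Qed.

(* Below its smallest letter [n], a positive word is the identity at [1 - n],
   while it moves that point as soon as [n] occurs in it. *)
Lemma thP_line_neq n s t : all (ltn n) t -> thP thA thB (n :: s) <> thP thA thB t.
Proof.
move=> nt E; have := congr1 (fun f : lineAut R => f (1 - n%:R)) E.
rewrite (thP_line_fix nt) thP_line_cons => En.
have := thP_line_ge s (1 - n%:R).
have := thX_line_ge n (thP thA thB s (1 - n%:R)); rewrite En => a b.
have E1 : thP thA thB s (1 - n%:R) = 1 - n%:R by apply/le_anti; rewrite a b.
by have := thX_line_gt n; rewrite E1 in En; rewrite En ltxx.
Qed.

(** If the first letters differ, the smaller one is below every letter of the other word, and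
    [thP_line_neq] separates them; equal first letters cancel. *)
Lemma thP_line_inj s t : sorted leq s -> sorted leq t ->
  thP thA thB s = thP thA thB t -> s = t.
Proof.
elim: s t => [|n s IHs] [|m t] //= ns mt.
- by move=> /esym /(@thP_line_neq m t [::] isT).
- by move=> /(@thP_line_neq n s [::] isT).
have ltn_all (i j : nat) r : path leq j r -> (i < j)%N -> all (ltn i) (j :: r).
  move=> jr ij /=; rewrite ij /=; apply/allP => k kr.
  by apply: (leq_trans ij); exact: (allP (order_path_min leq_trans jr)).
have [nm|mn|<-] := ltngtP n m.
- by move=> /(thP_line_neq (ltn_all _ _ _ mt nm)).
- by move=> /esym /(thP_line_neq (ltn_all _ _ _ ns mn)).
- by move=> /mulgI /IHs ->; rewrite ?(path_sorted ns) ?(path_sorted mt).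
Qed.

(** The supports (0, oo) and (-oo, -n) are disjoint. *)
Lemma thA_commute n : commute thA (thX thA thB n.+2).
Proof.
apply/commute_sym/(@commute_half_lines _ _ _ 0) => x x0; first exact: thA_le0.
have n0 : 0 <= n%:R :> R by [].
by rewrite thX_line -natr1 thB_ge1; lra.
Qed.

Lemma thA_rm : right_moving [set x : R | 0 < x] thA.
Proof.
have thA0 : thA 0 = 0 by rewrite thA_le0.
split=> [x y /= x0 y0 z /andP[xz _]|x x0|x x0|x /thA_gt//].
- exact: lt_le_trans xz.
- by rewrite /mkset -{1}thA0 la_mono.
- by rewrite /mkset la_gtV thA0.
Qed.

Lemma thB_rm : right_moving [set x : R | x < 1] thB.
Proof.
have thB1 : thB 1 = 1 by rewrite thB_ge1.
split=> [x y /= x0 y0 z /andP[_ zy]|x x0|x x0|x /thB_gt//].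
- exact: le_lt_trans y0.
- by rewrite /mkset -[ltRHS]thB1 la_mono.
- by rewrite /mkset la_ltV thB1.
Qed.

(* Locked because rewriting with [laM] would unfold the commutator. *)
Definition thE : lineAut R := locked (thA^-1 * (thB^-1 * (thA * thB)))%g.

(** Because AB is the translation, E x = A^-1 B^-1 (x + 1), and a value of [thE] can be checked
    without computing inverses. *)
Lemma thE_eq x y : thB (thA y) = x + 1 -> thE x = y.
Proof.
by move=> E; rewrite /thE -lock -(laK thA y) -(laK thB (thA y)) E -thAB.
Qed.

Lemma thE_out x : ~ (-1 < x < 1) -> thE x = x.
Proof.
move=> /negP; rewrite negb_and -!leNgt => /orP[x1|x1]; apply: thE_eq.
  by rewrite thA_le0 ?thB_leN1 //; lra.
by rewrite thA_ge1 ?thB_ge1 //; lra.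
Qed.

Lemma thE_01 x : 0 <= x <= 1 -> thE x = (x + 1) / 2.
Proof.
move=> /andP[x0 x1]; apply: thE_eq.
have -> : thA ((x + 1) / 2) = x + 1 by rewrite thA_01 //; lra.
by rewrite thB_ge1; lra.
Qed.

Lemma thE_gt x : -1 < x < 1 -> x < thE x.
Proof.
move=> /andP[x0 x1]; have [x2|x2] := lerP 0 x.
  by rewrite thE_01 ?x2 ?ltW //; lra.
(* On [-1, 0] the commutator has two affine pieces, 2 x + 1 and x + 1/2, meeting at -1/2. *)
have [x3|x3] := lerP x (- 2^-1).
  rewrite (@thE_eq x (2 * x + 1)); first by lra.
  by rewrite thA_le0 ?thB_mid //; lra.
rewrite (@thE_eq x (x + 2^-1)); first by lra.
by rewrite thA_01 ?thB_mid //; lra.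
Qed.

Lemma thE_rm : right_moving [set x : R | -1 < x < 1] thE.
Proof.
by apply: rm_between; [apply: thE_out; lra|apply: thE_out; lra|exact: thE_gt].
Qed.

End ThompsonOnTheLine.

(** * A free pair *)

Section FreePair.
Variable R : realType.
Local Notation E := (thE R).
Local Notation J := [set x : R | -1 < x < 1].
Local Notation E4 := ((E ^+ 4)%g : lineAut R).

Lemma zpow_expg (G : groupType) (S : G) k n : zpow (S ^+ k)%g n = zpow S (k%:Z * n).
Proof.
have XE m : zpow (S ^+ k)%g (Posz m) = zpow S (k%:Z * m%:Z) by rewrite -PoszM /= expgnA.
by case: n => m; rewrite ?XE // NegzE mulrN !zpowN XE.
Qed.

Lemma zpowDE (S : lineAut R) (m n : int) x : zpow S (m + n) x = zpow S m (zpow S n x).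
Proof. by rewrite zpowD. Qed.

Lemma bump0 : J 0. Proof. by move=> /=; lra. Qed.

Lemma thE1 : E 0 = 1 / 2. Proof. by rewrite thE_01; lra. Qed.
Lemma thE2 : zpow E 2 0 = 3 / 4.
Proof. by rewrite (zpowS E 1) laM zpow1 thE1 thE_01; lra. Qed.
Lemma thE3 : zpow E 3 0 = 7 / 8.
Proof. by rewrite (zpowS E 2) laM thE2 thE_01; lra. Qed.

Lemma thE4_01 x : 0 <= x <= 1 -> E4 x = (x + 15) / 16.
Proof.
move=> /andP[x0 x1]; change (E (E (E (E x))) = (x + 15) / 16).
rewrite (@thE_01 _ x) ?x0 // (@thE_01 _ ((x + 1) / 2)); last by lra.
by rewrite (@thE_01 _ (((x + 1) / 2 + 1) / 2)) ?thE_01; lra.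
Qed.

Lemma pinch_slope1 : (0 : R) < 1 / 7. Proof. by lra. Qed.
Lemma pinch_slope2 : (0 : R) < 73 / 16. Proof. by lra. Qed.

(** The first piece takes [0, 7/8] onto [9/16, 11/16], well inside (1/2, 3/4). The second takes
    15/16 = E^4 0 to 249/256 = E^4 (9/16), as equivariance requires. *)
Lemma pinch_glue : affine pinch_slope1 (9 / 16) (7 / 8) =
  affine pinch_slope2 (- (423 / 128)) (7 / 8).
Proof. by rewrite !affineE; lra. Qed.

(* On the circle J / E^4 the map [h] is hyperbolic: it pushes three quarters of
   a fundamental domain, [0, E^3 0], into the second quarter. *)
Lemma hyperbolic_ex : exists h : lineAut R,
  [/\ forall x, ~ J x -> h x = x,
      forall x, J x -> J (h x),
      forall x, J x -> J ((h^-1)%g x),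
      forall x, J x -> h (E4 x) = E4 (h x) &
      h 0 = 9 / 16 /\ h (zpow E 3 0) = 11 / 16].
Proof.
pose beta := la_glue pinch_glue.
have rm4 : right_moving J E4 by apply/rm_expg/thE_rm.
have E40 : E4 0 = 15 / 16 by rewrite thE4_01; lra.
have b0 : beta 0 = 9 / 16 by rewrite la_glue_lt ?affineE; lra.
have b3 : beta (7 / 8) = 11 / 16 by rewrite la_glue_ge // affineE; lra.
have [||h [hN hJ hJ' hS hb]] := equivariant_extension rm4 rm4 bump0 (beta := beta).
- by rewrite b0 /=; lra.
- by rewrite b0 E40 thE4_01 ?la_glue_ge ?affineE; lra.
exists h; split=> //; rewrite thE3 !hb ?E40 ?b0 ?b3 //; lra.
Qed.

(** The four open arcs cut out on the circle J / E^4 by the orbit of 0 under E, lifted to [J]. The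
    index counts modulo 4, and E rotates by one arc. *)
Definition quarter (k : int) : set R :=
  [set x | exists n : int, zpow E (4 * n + k) 0 < x < zpow E (4 * n + k + 1) 0].

Lemma quarter_cell k x : quarter k x -> exists n : int, in_cell E 0 (4 * n + k) x.
Proof. by case=> n /andP[a b]; exists n; rewrite /in_cell (ltW a). Qed.

Lemma quarterJ k : quarter k `<=` J.
Proof.
move=> x [n /andP[a b]]; have rm := thE_rm R.
have := rm_zpow (4 * n + k) rm bump0; have := rm_zpow (4 * n + k + 1) rm bump0.
by move=> /= /andP[? ?] /andP[? ?]; apply/andP; split; lra.
Qed.

Lemma quarter_disjoint k l x : quarter k x -> quarter l x -> (4 %| k - l)%Z.
Proof.
move=> /quarter_cell[n nx] /quarter_cell[m mx].
have := in_cell_uniq (thE_rm R) bump0 nx mx; move=> nm.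
by apply/dvdzP; exists (m - n); lia.
Qed.

(** As an endpoint of arcs, 0 is outside all of them and can serve as base point for ping-pong. *)
Lemma quarter_out k : ~ quarter k 0.
Proof.
move=> q; have /quarter_cell[n n0] := q; case: q => m /andP[a b].
have c0 : in_cell E 0 0 0 by rewrite /in_cell add0r zpow1 thE1 zpow0 la1; lra.
have cm : in_cell E 0 (4 * m + k) 0 by rewrite /in_cell (ltW a) b.
by move: a; rewrite (in_cell_uniq (thE_rm R) bump0 cm c0) ltxx.
Qed.

Lemma quarterE k x : quarter (k + 1) (E x) <-> quarter k x.
Proof.
have ES n y : (zpow E (n + 1) 0 < E y) = (zpow E n 0 < y).
  by rewrite zpowS laM la_mono.
have ES' n y : (E y < zpow E (n + 1) 0) = (y < zpow E n 0).
  by rewrite zpowS laM la_mono.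
have cell n : (zpow E (4 * n + (k + 1)) 0 < E x < zpow E (4 * n + (k + 1) + 1) 0) =
    (zpow E (4 * n + k) 0 < x < zpow E (4 * n + k + 1) 0).
  by rewrite !addrA ES ES'.
by split=> -[n ab]; exists n; rewrite cell in ab *.
Qed.

Lemma quarter4 k : quarter (k + 4) = quarter k.
Proof.
apply/seteqP; split=> x [n ab].
  exists (n + 1); have -> : 4 * (n + 1) + k = 4 * n + (k + 4) by lia.
  by [].
exists (n - 1); have -> : 4 * (n - 1) + (k + 4) = 4 * n + k by lia.
by [].
Qed.

Variable h : lineAut R.
Hypothesis hJ : forall x, J x -> J (h x).
Hypothesis hJ' : forall x, J x -> J ((h^-1)%g x).
Hypothesis hS : forall x, J x -> h (E4 x) = E4 (h x).
Hypothesis h0 : h 0 = 9 / 16.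
Hypothesis h3 : h (zpow E 3 0) = 11 / 16.

Lemma hyperbolic_zpow n x : J x -> h (zpow E (4 * n) x) = zpow E (4 * n) (h x).
Proof.
move=> Jx; rewrite -[4]/(Posz 4) -zpow_expg.
by apply: zpow_equivariant Jx => //; apply/rm_expg/thE_rm.
Qed.

Lemma hyperbolic_cell x : J x -> exists n : int,
  [/\ zpow E (4 * n) 0 <= x, x < zpow E (4 * n + 4) 0 & zpow E (4 * n) (9 / 16) <= h x].
Proof.
move=> Jx; have rm4 : right_moving J E4 by apply/rm_expg/thE_rm.
have [n /andP[]] := in_cell_ex rm4 bump0 Jx; rewrite !zpow_expg mulrDr => a b.
exists n; split=> //.
by rewrite -h0 -hyperbolic_zpow ?la_mono_le //; exact: bump0.
Qed.

(** The map [h] never takes a point below the left end of its cell of [E4]; one application of [E4]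
    then passes the right end. So E^4 h has no fixed point in [J]. *)
Lemma hyperbolic_gt x : J x -> x < E4 (h x).
Proof.
move=> /hyperbolic_cell[n [_ xn hx]]; apply: (lt_trans xn).
rewrite (addrC (4 * n)) zpowDE -[zpow E 4]/E4 la_mono; apply: lt_le_trans hx.
by rewrite la_mono; lra.
Qed.

(** What remains of a cell is a translate of [0, E^3 0], which [h] sends into the same translate of
    [9/16, 11/16]. *)
Lemma hyperbolic_pp x : J x -> ~ quarter 3 x -> quarter 1 (h x).
Proof.
move=> Jx q3; have [n [nx xn hx]] := hyperbolic_cell Jx.
have xn3 : x <= zpow E (4 * n + 3) 0.
  rewrite leNgt; apply/negP => n3; apply: q3; exists n; rewrite n3 /=.
  by rewrite -addrA.
exists n; apply/andP; split.
  apply: lt_le_trans hx; rewrite zpowDE la_mono zpow1 thE1; lra.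
rewrite -(la_mono_le h) zpowDE hyperbolic_zpow in xn3; last first.
  by rewrite thE3 /=; lra.
apply: le_lt_trans xn3 _.
have -> : 4 * n + 1 + 1 = 4 * n + 2 by lia.
by rewrite (zpowDE _ (4 * n) 2) la_mono thE2 h3; lra.
Qed.

Definition free_pair (i : 'I_2) : lineAut R :=
  if i == ord0 then h else (E * h * E^-1)%g.

(** Attracting arcs: 1 for [h] and 3 for its inverse; conjugation by E rotates these to 2 and to 4,
    that is 0. The four arcs are distinct. *)
Definition free_pair_quarter (l : 'I_2 * bool) : set R :=
  quarter (if l.1 == ord0 then if l.2 then 3 else 1 else if l.2 then 0 else 2).

Lemma hyperbolic_ppV x : J x -> ~ quarter 1 x -> quarter 3 ((h^-1)%g x).
Proof.
move=> Jx q1; apply: contrapT => /(hyperbolic_pp (hJ' Jx)).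
by rewrite laVK.
Qed.

Lemma free_pair_free (w : word 'I_2) :
  word_val free_pair w = 1%g -> pres_eq set0 w [::].
Proof.
have rmE := thE_rm R.
have q03 y : quarter 3 ((E^-1)%g y) <-> quarter 0 y.
  by rewrite -quarterE laVK -(quarter4 0) add0r.
have q12 y : quarter 1 ((E^-1)%g y) <-> quarter 2 y.
  by rewrite -quarterE laVK.
apply: (@ping_pong _ _ free_pair R (@la_fun R) J free_pair_quarter 0) => //.
- exact: bump0.
- by move=> l; exact: quarter_out.
- by move=> l; exact: quarterJ.
- have i2 (i j : 'I_2) : (i == ord0) = (j == ord0) -> i = j.
    by case: i => -[|[|//]] ?; case: j => -[|[|//]] ? //= _; apply: val_inj.
  move=> [i b] [j c] x /= qx /(quarter_disjoint qx) /=.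
  case ci: (i == ord0); case cj: (j == ord0); case: b {qx}; case: c => //= _;
    by congr (_, _); apply: i2; rewrite ci cj.
move=> i b y Jy; rewrite /free_pair_quarter /letter_val /free_pair /=.
have JE : J ((E^-1)%g y) by apply: (rm_bwd rmE).
case: (i == ord0) b => -[] /= nq.
- exact: hyperbolic_ppV.
- exact: hyperbolic_pp.
- change (quarter 0 (((E * h * E^-1)^-1)%g y)); rewrite !invgM invgK.
  apply/q03; rewrite !laM laK.
  by apply: hyperbolic_ppV => // /q12.
- change (quarter 2 ((E * h * E^-1)%g y)); apply/q12; rewrite !laM laK.
  by apply: hyperbolic_pp => // /q03.
Qed.

End FreePair.

(** * The square root *)

Section SquareRoot.
Variable R : realType.
Local Notation A := (thA R).
Local Notation B := (thB R).
Local Notation E := (thE R).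
Local Notation J := [set x : R | -1 < x < 1].

Lemma conjugate_bumps (M : lineAut R) :
  right_moving J M -> (forall x, ~ J x -> M x = x) ->
  exists eta : lineAut R, [/\ forall x, ~ J x -> eta x = x,
    forall x, J x -> J (eta x) & (eta * E * eta^-1)%g = M].
Proof.
move=> rmM MN; have M0 : 0 < M 0 by apply: (rm_lt rmM (bump0 R)).
have M2 : 0 < 2 * M 0 by rewrite mulr_gt0.
(* The scaling by 2 (M 0) fixes 0 and sends E 0 = 1/2 to M 0, hence a fundamental domain of E to one
   of M. *)
have [||eta [etaN etaJ _ etaE _]] :=
    equivariant_extension (thE_rm R) rmM (bump0 R) (beta := affine M2 0).
- by rewrite affineE mulr0 addr0; exact: bump0.
- by rewrite !affineE mulr0 !addr0 thE1; lra.
exists eta; split=> //; apply: (canLR (mulgK _)); apply: lineAut_eq => x.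
rewrite !laM; have [Jx|Jx] := pselect (J x); first exact: etaE.
by rewrite thE_out // etaN // MN.
Qed.

(** Membership is stated for every subgroup containing f and g, a form that passes to the interval
    by taking preimages. *)
Lemma square_root_line : exists f g h : lineAut R,
  [/\ (f ^+ 2)%g = A /\ (g ^+ 2)%g = B,
      [set x | f x <> x] = [set x | 0 < x],
      [set x | g x <> x] = [set x | x < 1],
      forall H : set (lineAut R), is_subgroup H -> H f -> H g ->
        forall i, H (free_pair h i) &
      forall w : word 'I_2, word_val (free_pair h) w = 1%g -> pres_eq set0 w [::]].
Proof.
have [h [hN hJ hJ' hS [h0 h3]]] := hyperbolic_ex R.
have h_gt := hyperbolic_gt hS h0.
pose M := (E ^+ 4 * h)%g.
have rm4 : right_moving J (E ^+ 4)%g by apply/rm_expg/thE_rm.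
have rmM : right_moving J M.
  split; [exact: rm_itv rm4| | |exact: h_gt] => x Jx.
    by rewrite laM; apply/(rm_fwd rm4)/hJ.
  by rewrite invgM laM; apply/hJ'/(rm_bwd rm4).
have E4N x : ~ J x -> (E ^+ 4)%g x = x.
  by move=> Jx; change (E (E (E (E x))) = x); rewrite !thE_out.
have MN x : ~ J x -> M x = x by move=> Jx; rewrite laM hN // E4N.
have [eta [etaN etaJ etaM]] := conjugate_bumps rmM MN.
pose t := (A * B)%g; have tE x : t x = x + 1 by apply: thAB.
have tVE x : (t^-1)%g x = x - 1 by apply: la_eqV; rewrite tE subrK.
(* Words in A and B that carry J = (-1, 1) onto (1, 3/2) and (3/2, 2). *)
pose u := (t * B * t^-1 * B)%g; pose v := (t * B * B)%g.
have uE x : u x = t (B ((t^-1)%g (B x))) by [].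
have vE x : v x = t (B (B x)) by [].
have BN1 : B (-1) = 0 by rewrite thB_leN1 //; lra.
have B0 : B 0 = 2^-1 by rewrite thB_mid; lra.
have B1 : B 1 = 1 by rewrite thB_ge1.
have uN1 : u (-1) = 1 by rewrite uE BN1 tVE add0r BN1 tE add0r.
have u1 : u 1 = 3 / 2 by rewrite uE B1 tVE subrr B0 tE; lra.
have vN1 : v (-1) = 3 / 2 by rewrite vE BN1 B0 tE; lra.
have v1 : v 1 = 2 by rewrite vE B1 B1 tE; lra.
have JN1 : ~ J (-1) by rewrite /=; lra.
have J1 : ~ J 1 by rewrite /=; lra.
(* As eta fixes -1 and 1, theta takes 1 to 3/2 and 3/2 to 2 = A 1, so it is admissible as the first
   half of a root of A based at 1. *)
pose theta := (v * eta * u^-1)%g.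
have thetaE x : theta x = v (eta ((u^-1)%g x)) by [].
have theta1 : theta 1 = 3 / 2 by rewrite thetaE (la_eqV uN1) etaN.
have theta2 : theta (3 / 2) = 2 by rewrite thetaE (la_eqV u1) etaN.
have [x||||f [f2 fsupp ft]] :=
  square_root_extension (thA_rm R) (theta := theta) (p := 1).
- by move=> /negP; rewrite -leNgt; apply: thA_le0.
- exact: ltr01.
- by rewrite theta1; lra.
- by rewrite theta1 theta2 thA_ge1; lra.
have BS x : ~ (x < 1) -> B x = x by move=> /negP; rewrite -leNgt; apply: thB_ge1.
(* Near -2 the map B is the translation by 1, so the translation by 1/2 starts a root. *)
have [||||g [g2 gsupp _]] := square_root_extension (thB_rm R)
    (theta := affine (@ltr01 R) 2^-1) (p := -2).
- exact: BS.
- by rewrite /=; lra.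
- by rewrite affineE; lra.
- by rewrite !affineE thB_leN1; lra.
exists f, g, h; split=> //; last exact: free_pair_free.
move=> H sH Hf Hg.
have mulH x y : H x -> H y -> H (x * y)%g by apply: subgroupM.
have invH x : H x -> H (x^-1)%g by apply: subgroupV.
have HA : H A by rewrite -f2 expg2; apply: mulH.
have HB : H B by rewrite -g2 expg2; apply: mulH.
have Ht : H t by apply: mulH.
have HE : H E.
  rewrite /thE -lock.
  exact: mulH _ _ (invH _ HA) (mulH _ _ (invH _ HB) Ht).
have Hu : H u := mulH _ _ (mulH _ _ (mulH _ _ Ht HB) (invH _ Ht)) HB.
have Hv : H v := mulH _ _ (mulH _ _ Ht HB) HB.
have uJ x : J ((u^-1)%g x) <-> 1 < x < 3 / 2.
  by rewrite /mkset la_gtV la_ltV uN1 u1.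
have conj_cancel (a b c d : lineAut R) :
    (a * b * c^-1 * (c * d * c^-1) * (a * b * c^-1)^-1 = a * (b * d * b^-1) * a^-1)%g.
  by rewrite !invgM invgK !mulgA !mulgVK.
have conj_back (a b : lineAut R) : (b = a^-1 * (a * b * a^-1) * a)%g.
  by rewrite !mulgA mulVg mul1g mulgVK.
(* The support of u E u^-1 is the bump (1, 3/2), where f agrees with theta; then u cancels and eta
   turns E into M. *)
have fuE : (f * (u * E * u^-1) * f^-1 = v * M * v^-1)%g.
  rewrite (@conj_agree _ f theta _ [set x | 1 < x < 3 / 2]).
  - by rewrite -etaM; exact: conj_cancel.
  - move=> x x1; change (u (E ((u^-1)%g x)) = x).
    by rewrite thE_out ?laVK // => /uJ.
  - move=> x /uJ Jx; apply/uJ.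
    change (J ((u^-1)%g (u (E ((u^-1)%g x))))); rewrite laK.
    exact: (rm_fwd (thE_rm R)).
  - by move=> x /andP[a b]; apply: ft; rewrite theta1 (ltW a) (ltW b).
have HM : H M.
  have -> : M = (v^-1 * (f * (u * E * u^-1) * f^-1) * v)%g.
    by rewrite fuE; exact: conj_back.
  have HuE : H (u * E * u^-1)%g := mulH _ _ (mulH _ _ Hu HE) (invH _ Hu).
  have HfuE := mulH _ _ (mulH _ _ Hf HuE) (invH _ Hf).
  exact: mulH _ _ (mulH _ _ (invH _ Hv) HfuE) Hv.
have Hh : H h.
  have -> : h = ((E ^+ 4)^-1 * M)%g by rewrite mulKg.
  by apply: mulH => //; apply: invH; exact: (zpow_subgroup 4 sH HE).
move=> i; rewrite /free_pair; case: ifP => _ //.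
exact: mulH _ _ (mulH _ _ HE Hh) (invH _ HE).
Qed.

Lemma homeo_of1 : homeo_of (1%g : lineAut R) = 1%g.
Proof.
by apply: (mulgI (homeo_of (1%g : lineAut R))); rewrite -homeo_ofM !mulg1.
Qed.

HB.instance Definition _ := isUMagmaMorphism.Build (lineAut R) (homeoI R)
  (@homeo_of R) (homeo_of1, @homeo_ofM R).

End SquareRoot.

(** * Transport to the unit interval *)

Lemma preimage_subgroup (G K : groupType) (phi : UMagmaMorphism.type G K) (H : set K) :
  is_subgroup H -> is_subgroup (phi @^-1` H).
Proof.
move=> sH; split=> [|x y /set_mem Hx /set_mem Hy]; apply/mem_set.
  by rewrite /preimage /mkset gmulf1; apply: subgroup1.
by rewrite /preimage /mkset gmulfF; apply: subgroupF.
Qed.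

Lemma word_val_morph (X : choiceType) (G K : groupType)
    (phi : UMagmaMorphism.type G K) (e : X -> G) (w : word X) :
  word_val (phi \o e) w = phi (word_val e w).
Proof.
elim: w => [|[x b] w IHw] /=; first by rewrite gmulf1.
by rewrite IHw gmulfM; case: b; rewrite /letter_val //= gmulfV.
Qed.

Lemma squash_rays (R : realType) :
  @squash R @` [set x | 0 < x] = [set` `]squash 0, 1[] /\
  @squash R @` [set x | x < 1] = [set` `]0, squash 1[].
Proof.
have sq01 (y : R) : 0 < y < 1 -> squash (unsquash y) = y by exact: unsquashK.
split; apply/seteqP; split=> [_ [x /= x0 <-]|y] /=; rewrite in_itv /=.
- by rewrite squash_mono x0; case/andP: (squash_itv x).
- move=> /andP[y0 y1]; have yE : squash (unsquash y) = y.
    by rewrite sq01 // y1 (lt_trans _ y0) //; case/andP: (squash_itv (0 : R)).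
  by exists (unsquash y) => //=; rewrite -squash_mono yE.
- by rewrite squash_mono x0 andbT; case/andP: (squash_itv x).
- move=> /andP[y0 y1]; have yE : squash (unsquash y) = y.
    by rewrite sq01 // y0 (lt_trans y1) //; case/andP: (squash_itv (1 : R)).
  by exists (unsquash y) => //=; rewrite -squash_mono yE.
Qed.

Lemma two_chain_itv (R : realType) (a b c d : R) : a < b -> b < c -> c < d ->
  two_chain [set` `]b, d[] [set` `]a, c[].
Proof.
move=> ab bc cd.
have oi (x y : R) : x < y -> open_interval [set` `]x, y[].
  move=> xy; split; [|exact: interval_open|exact: interval_is_interval].
  by exists ((x + y) / 2); rewrite /= in_itv /=; lra.
split; [exact: oi (lt_trans bc cd)|exact: oi (lt_trans ab bc)|split| |].
- move=> x y [xb xa] [yb ya] z xyz; split.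
    exact: (interval_is_interval xb yb).
  exact: (interval_is_interval xa ya).
- by exists ((b + c) / 2); split; rewrite /= in_itv /=; lra.
(* The end c of the second interval lies in the first one only; in the next case b plays the
   symmetric part. *)
- split=> [x []//|/(_ c)[|_]]; rewrite /= in_itv /=; lra.
- split=> [x []//|/(_ b)[|+ _]]; rewrite /= in_itv /=; lra.
Qed.

Theorem corollary1p6 (R : realType) :
  exists G : set (homeoI R),
    square_root_of_F G /\
    exists H : set (homeoI R),
      [/\ is_subgroup H, H `<=` G & isomorphic H (free_group 2)].
Proof.
have [f [g [h [[f2 g2] fsupp gsupp Hh free]]]] := square_root_line R.
pose phi : UMagmaMorphism.type (lineAut R) (homeoI R) := @homeo_of R.
pose G := generated [set phi f; phi g].
have sG : is_subgroup G by apply: generated_subgroup.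
exists G; split.
  exists (phi f), (phi g); split=> //.
    rewrite -!gmulfXn f2 g2; apply: thompson_isomorphic.
    - by rewrite -thX_morph /commute -!gmulfM thA_commute.
    - by rewrite -thX_morph /commute -!gmulfM thA_commute.
    - move=> s t ss st; rewrite -!thP_morph => /homeo_of_inj.
      exact: thP_line_inj.
  rewrite /phi !supp_homeo_of fsupp gsupp; have [-> ->] := squash_rays R.
  have /andP[s0 _] := squash_itv (0 : R); have /andP[_ s1] := squash_itv (1 : R).
  by apply: two_chain_itv => //; rewrite squash_mono.
(* Injectivity of [homeo_of] keeps the pair free; its image is in [G] because the preimage of [G] is
   a subgroup containing f and g. *)
have [w|H [sH HG HF]] := @free_isomorphic _ 2 (phi \o free_pair h).
  by rewrite word_val_morph -(homeo_of1 R) => /homeo_of_inj /free.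
exists H; split=> //; apply: HG => // i.
apply: (Hh _ (preimage_subgroup phi sG)); apply: sub_generated.
  by left.
by right.
Qed.
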